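(* (Abstract Bochner Theorem) Let $A$ be a commutative normed $*$-algebra. The formula $$\psi(a)=\int \hat a\,d\mu\qquad(a\in A)$$ establishes an affine bijection $\mu\mapsto\psi$ from $M_1\bigl(\Delta^*_{bsa}(A)\bigr)$ onto $S(A)$.
   Context: All algebras are complex. A normed $*$-algebra is a $*$-algebra with a submultiplicative norm (no unit, completeness, or continuity of the involution is assumed). $A_{sa}=\{a\in A:a=a^*\}$. A linear functional $\varphi$ on $A$ is positive if $\varphi(a^*a)\geq0$ for all $a$; it is Hermitian if $\varphi(a^* )=\overline{\varphi(a)}$ for all $a$. A positive linear functional $\varphi$ is weakly continuous on $A_{sa}$ if for each $b\in A$ the functional $a\mapsto\varphi(b^*ab)$ is continuous on $A_{sa}$. It has finite variation if there is $v\ge0$ with $|\varphi(a)|^2\leq v\,\varphi(a^*a)$ for all $a\in A$; the least such $v$ is its variation $v(\varphi)$. $S(A)$ is the (convex) set of states on $A$, i.e. of positive linear functionals that are weakly continuous on $A_{sa}$ and have finite variation equal to $1$. $\Delta^*_{bsa}(A)$ is the set of non-zero multiplicative linear functionals $\tau:A\to\mathbb{C}$ that are Hermitian and bounded on $A_{sa}$. It is given the topology of pointwise convergence on $A_{sa}$ (the relative weak* topology from the dual of the real normed space $A_{sa}$), for which it is a locally compact Hausdorff space. For $a\in A$, $\hat a(\tau)=\tau(a)$ for $\tau\in\Delta^*_{bsa}(A)$. For a locally compact Hausdorff space $\Omega$, $M_1(\Omega)$ is the set of inner regular Borel probability measures on $\Omega$, where inner regular means $\mu(\omega)=\sup\{\mu(K):K\subset\omega\text{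 compact}\}$ for all Borel sets $\omega$ (so $M_1(\varnothing)=\varnothing$). *)

(* Defs.v *)
From HB Require Import structures.
From mathcomp Require Import all_boot all_order all_algebra complex.
From mathcomp Require Import all_classical all_reals all_analysis.

Set Implicit Arguments.
Unset Strict Implicit.
Unset Printing Implicit Defensive.

Import Order.TTheory GRing.Theory Num.Theory.
Import numFieldNormedType.Exports.

Local Open Scope classical_set_scope.
Local Open Scope ring_scope.
Local Open Scope complex_scope.

(* MathComp rings are unital, so the possibly non-unital multiplication is
   added to a normed complex vector space. The norm of a [normedModType R[i]]
   takes its values in the nonnegative reals of [R[i]]; neither completeness
   nor continuity of the involution is required. *)
HB.mixin Record isNormedStarAlgebra (R : realType) A & NormedModule R[i] A := {
  amul : A -> A -> A;
  star : A -> A;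
  amulA : associative amul;
  amulDl : left_distributive amul +%R;
  amulDr : right_distributive amul +%R;
  amulZl : forall (k : R[i]) (x y : A), amul (k *: x) y = k *: amul x y;
  amulZr : forall (k : R[i]) (x y : A), amul x (k *: y) = k *: amul x y;
  starK : involutive star;
  starD : {morph star : x y / x + y};
  starZ : forall (k : R[i]) (x : A), star (k *: x) = k^*%R *: star x;
  starM : forall x y : A, star (amul x y) = amul (star y) (star x);
  ler_normM : forall x y : A, `|amul x y| <= `|x| * `|y|
}.

#[short(type="normedStarAlgType")]
HB.structure Definition NormedStarAlgebra (R : realType) :=
  {A of NormedModule R[i] A & isNormedStarAlgebra R A}.

Section functionals.
Context {R : realType} {A : normedStarAlgType R}.
Implicit Types phi tau : A -> R[i].

Definition selfadjoint : set A := [set a | star a = a].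

Definition positive_functional phi :=
  scalar phi /\ forall a, 0 <= phi (amul (star a) a).

Definition hermitian_functional phi := forall a, phi (star a) = (phi a)^*%R.

Definition weakly_continuous_sa phi := forall b,
  {within selfadjoint,
    continuous (fun a => phi (amul (amul (star b) a) b) : R[i]^o)}.

Definition variation_bounds phi : set R :=
  [set v | 0 <= v /\
           forall a, `|phi a| ^+ 2 <= v%:C * phi (amul (star a) a)].

Definition has_variation phi (v : R) :=
  variation_bounds phi v /\ lbound (variation_bounds phi) v.

Definition states : set (A -> R[i]) :=
  [set phi | [/\ positive_functional phi, weakly_continuous_sa phi
               & has_variation phi 1]].

Definition bounded_sa phi :=
  exists M : R, forall a, selfadjoint a -> `|phi a| <= M%:C * `|a|.

Definition characters : set (A -> R[i]) :=
  [set tau | [/\ scalar tau,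
                 forall a b, tau (amul a b) = tau a * tau b,
                 exists a, tau a != 0,
                 hermitian_functional tau
               & bounded_sa tau]].

Definition eval_sa (tau : characters) : {ptws selfadjoint -> R[i]^o} :=
  fun a => set_val tau (set_val a).

End functionals.

Arguments characters {R} A.
Arguments states {R} A.

(* [characters A] with the topology of pointwise convergence on [A_sa] *)
Definition spectrum (R : realType) (A : normedStarAlgType R) : Type :=
  initial_topology (@eval_sa R A).

HB.instance Definition _ (R : realType) (A : normedStarAlgType R) :=
  Topological.on (@spectrum R A).

Definition gelfand (R : realType) (A : normedStarAlgType R) (a : A)
  (tau : spectrum A) : R[i] := set_val (tau : characters A) a.

(* Measurable types are pointed, whereas a topological space may be empty.
   The Borel space of [T] is therefore built from a point [x] of [T], which
   influences neither the measurable sets nor the integral. *)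
Definition pointed_at (T : Type) (x : T) : Type := T.

Section borel.
Variables (T : topologicalType) (x : T).

HB.instance Definition _ := Choice.on (pointed_at x).
HB.instance Definition _ := isPointed.Build (pointed_at x) x.

Definition borel := g_sigma_algebraType (@open T : set (set (pointed_at x))).
HB.instance Definition _ := Measurable.on borel.

End borel.

Definition inner_regular (R : realType) (T : topologicalType)
    (mu : set T -> \bar R) :=
  forall B : set T, <<s @open T >> B ->
    mu B = ereal_sup [set mu K | K in [set K | compact K /\ K `<=` B]].

(* The base point exists for every probability measure, since the space then is
   nonempty; in particular [M1 R T] has no element when [T] is empty. *)
Record M1 (R : realType) (T : topologicalType) := BuildM1 {
  M1_point : T;
  M1_prob :> probability (borel M1_point) R;
  M1_inner_regular : @inner_regular R T M1_prob
}.

(* Measures are functions on all subsets of which only the values on Borel sets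
   matter. Hence equality of Borel measures is agreement on Borel sets, and
   convex combinations are also specified there. *)
Definition M1_eq (R : realType) (T : topologicalType) (mu nu : M1 R T) :=
  forall B : set T, <<s @open T >> B -> M1_prob mu B = M1_prob nu B.

Definition M1_conv (R : realType) (T : topologicalType) (t : R)
    (mu nu rho : M1 R T) :=
  forall B : set T, <<s @open T >> B ->
    M1_prob rho B = (t%:E * M1_prob mu B + (1 - t)%:E * M1_prob nu B)%E.

Section complex_integral.
Context d {T : measurableType d} {R : realType}.
Variable mu : {measure set T -> \bar R}.

Definition cintegrable (f : T -> R[i]) :=
  mu.-integrable setT (fun x => (complex.Re (f x))%:E) /\
  mu.-integrable setT (fun x => (complex.Im (f x))%:E).

Definition cintegral (f : T -> R[i]) : R[i] :=
  (\int[mu]_x complex.Re (f x)) +i* (\int[mu]_x complex.Im (f x)).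

End complex_integral.

Definition bochner (R : realType) (A : normedStarAlgType R)
    (mu : M1 R (spectrum A)) (a : A) : R[i] :=
  cintegral mu (gelfand a).

(* Main.v *)
From HB Require Import structures.
Require Import Defs.
From mathcomp Require Import all_boot all_order all_algebra complex ring lra.
From mathcomp Require Import all_classical all_reals all_analysis.
From mathcomp Require Import measurable_realfun.

Set Implicit Arguments.
Unset Strict Implicit.
Unset Printing Implicit Defensive.

Import Order.TTheory GRing.Theory Num.Theory.
Import numFieldNormedType.Exports.

Local Open Scope classical_set_scope.
Local Open Scope ring_scope.
Local Open Scope complex_scope.

(** The selfadjoint part of [A] together with a unit is a commutative unital real
    algebra [B], and the spectrum together with a point at infinity, which stands
    for the zero functional on [A], is its space of characters that are bounded on
    [A].

    A state [phi] extends to a functional [phi1] on [B] with value 1 at the unit.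
    Finite variation makes [phi1] nonnegative at squares, and weak continuity
    together with the Cauchy-Schwarz inequality makes it contractive in the sense
    of [phi1_contractive]. The elements [b] with [phi1 (c^2 b) >= 0] for all [c]
    then form an archimedean quadratic module, so the [positivstellensatz], whose
    proof rests on Zorn's lemma and ring identities, shows that [phi1] is nonnegative at
    every element whose Gelfand transform is nonnegative ([phi1_pos]). Neither
    Hilbert space representations nor the spectral theorem enter. That [phi] is real
    on the selfadjoint part is a consequence ([state_sa_real]).

    The infimum of [phi1] over the elements whose transforms dominate the indicator
    of a compact set [K] is a content. It is additive over disjoint compact sets
    because the algebra contains approximate Urysohn functions ([algebra_urysohn]),
    by the argument of the Stone-Weierstrass theorem; it has total mass 1 because
    the variation of [phi] is exactly 1 ([state_tight]). By Caratheodory's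
    construction it comes from an inner regular probability measure
    ([content_representation]).

    A positive functional that is approximated on compact sets by the masses of a
    measure is integration with respect to that measure, by slicing functions into
    superlevel sets ([layer_cake_representation]). This recovers [phi1] from its
    measure. Applied to the integral of another measure, it shows that measures
    with the same masses have the same transform and that the transform is affine;
    conversely, the mass of a compact set is the infimum of the integrals of its
    majorants ([small_majorant]), whence injectivity. *)

Lemma scalar_morph (K : nzRingType) (V : lmodType K) (f : V -> K) : scalar f ->
  [/\ f 0 = 0, {morph f : a b / a + b}, {morph f : a / - a}
    & forall k a, f (k *: a) = k * f a].
Proof.
move=> fL; have f0 : f 0 = 0.
  by have := fL (-1) 0 0; rewrite scaler0 addr0 mulN1r addNr.
split=> // [a b|a|k a].
- by rewrite -[a in LHS]scale1r fL mul1r.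
- by rewrite -[- a]addr0 -scaleN1r fL f0 addr0 mulN1r.
- by rewrite -[_ *: _]addr0 fL f0 addr0.
Qed.

(** * An archimedean Positivstellensatz *)

Section quadratic_modules.
Context {R : realType} {B : comAlgType R}.
Implicit Types (M Q : set B) (b f s : B) (r : R).
Notation "r %:B" := (in_alg B r) (at level 2, format "r %:B").

Definition quadratic_module M :=
  [/\ M 1, forall b c, M b -> M c -> M (b + c)
         & forall c b, M b -> M (c * c * b)].

Definition archimedean_module M := forall b, exists r, M (r%:B - b).

Definition characters_on M : set (B -> R) :=
  [set sigma | [/\ scalar sigma, forall b c, sigma (b * c) = sigma b * sigma c,
                   sigma 1 = 1 & forall b, M b -> 0 <= sigma b]].

Lemma qm_scalar M r : quadratic_module M -> 0 <= r -> M r%:B.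
Proof.
move=> [M1 MD MM] r0.
suff -> : r%:B = (Num.sqrt r)%:B * (Num.sqrt r)%:B * 1 by exact: MM.
by rewrite mulr1 -rmorphM -expr2 sqr_sqrtr.
Qed.

Lemma qm0 M : quadratic_module M -> M 0.
Proof. by move=> qM; rewrite -(rmorph0 (in_alg B)); exact: qm_scalar. Qed.

Lemma qm_scale M r b : quadratic_module M -> 0 <= r -> M b -> M (r%:B * b).
Proof.
move=> [M1 MD MM] r0 Mb.
suff -> : r%:B = (Num.sqrt r)%:B * (Num.sqrt r)%:B by exact: MM.
by rewrite -rmorphM -expr2 sqr_sqrtr.
Qed.

Lemma qm_addr M b r : quadratic_module M -> 0 <= r -> M b -> M (b + r%:B).
Proof. by move=> qM r0 Mb; case: (qM) => _ MD _; apply: MD => //; exact: qm_scalar. Qed.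

Lemma qm_neg_scalar M r : quadratic_module M -> r < 0 -> M r%:B -> M (-1).
Proof.
move=> qM r0 Mr.
suff -> : -1 = (- r^-1)%:B * r%:B.
  by apply: qm_scale => //; rewrite oppr_ge0 invr_le0 ltW.
by rewrite -rmorphM mulNr mulVf ?lt_eqF// rmorphN rmorph1.
Qed.

(** This is the set of sums of squares. The description as the smallest quadratic
    module turns closure properties of sums of squares into inclusions. *)
Definition sos : set B := \bigcap_(M in quadratic_module) M.

Lemma sos_quadratic : quadratic_module sos.
Proof.
split=> [M []//|a c Sa Sc M qM|a c Sc M qM].
- by case: (qM) => _ MD _; apply: MD; [exact: Sa|exact: Sc].
- by case: (qM) => _ _ MM; apply: MM; exact: Sc.
Qed.

Lemma qm_sosM M s b : quadratic_module M -> sos s -> M b -> M (s * b).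
Proof.
move=> [M1 MD MM] Ss Mb.
suff /Ss : quadratic_module [set x | forall b, M b -> M (x * b)] by apply.
split=> [p|x y Hx Hy p Mp|c x Hx p Mp] /=.
- by rewrite mul1r.
- by rewrite mulrDl; apply: MD; [exact: Hx|exact: Hy].
- by rewrite -mulrA; apply: MM; exact: Hx.
Qed.

Definition adjoin_qm M b : set B :=
  [set x | exists q s, [/\ M q, sos s & x = q + s * b]].

Lemma adjoin_qmP M b : quadratic_module M ->
  [/\ quadratic_module (adjoin_qm M b), M `<=` adjoin_qm M b & adjoin_qm M b b].
Proof.
move=> qM; case: (qM) => M1 MD MM; case: sos_quadratic => S1 SD SM.
have S0 := qm0 sos_quadratic; have M0 := qm0 qM.
split; first split.
- by exists 1, 0; split=> //; ring.
- move=> _ _ [q [s [Mq Ss ->]]] [p [t [Mp St ->]]].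
  by exists (q + p), (s + t); split; [exact: MD|exact: SD|ring].
- move=> d _ [q [s [Mq Ss ->]]].
  by exists (d * d * q), (d * d * s); split; [exact: MM|exact: SM|ring].
- by move=> q Mq; exists q, 0; split=> //; ring.
- by exists 0, 1; split=> //; ring.
Qed.

Section maximal.
Variable Q : set B.
Hypothesis qQ : quadratic_module Q.
Hypothesis properQ : ~ Q (-1).
Hypothesis maxQ : forall Q', quadratic_module Q' -> ~ Q' (-1) ->
  Q `<=` Q' -> Q' = Q.

(** Otherwise [Q + S b] and [Q - S b] would both contain [-1], where [S] is the
    set of sums of squares; this yields a sum of squares [s] in the ideal
    [Q `&` - Q] such that [-1] belongs to [Q + s b]. *)
Lemma maximal_total b : Q b \/ Q (- b).
Proof.
case: (qQ) => Q1 QD QM.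
have sosQ s : sos s -> Q s by apply.
have nonmax c : ~ Q c -> adjoin_qm Q c (-1).
  move=> NQc; apply: contrapT => p; apply: NQc.
  by have [qe Qe] := adjoin_qmP c qQ; rewrite (maxQ qe p Qe).
have [|/nonmax[q1 [s1 [Qq1 Ss1 e1]]]] := pselect (Q b); first by left.
have [|/nonmax[q2 [s2 [Qq2 Ss2 e2]]]] := pselect (Q (- b)); first by right.
exfalso.
have Qs1N : Q (- s1).
  suff -> : - s1 = s2 + (s1 * q2 + s2 * q1).
    by apply: (QD); [exact: sosQ|apply: QD; exact: qm_sosM].
  have -> : q2 = - 1 + s2 * b by rewrite e2; ring.
  have -> : q1 = - 1 - s1 * b by rewrite e1; ring.
  ring.
(* Every element [b] is a quarter of [(b + 1)^2 - (b - 1)^2], so that [Q] and [- Q]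
   intersect in an ideal. *)
have Qs1b : Q (s1 * b).
  have four : (4^-1)%:B *+ 4 = 1 :> B.
    by rewrite -rmorphMn -mulr_natr mulVf ?pnatr_eq0// rmorph1.
  have -> : s1 * b =
      (4^-1)%:B * ((b + 1) * (b + 1) * s1 + (b - 1) * (b - 1) * - s1).
    by rewrite -[LHS]mul1r -[X in X * _ = _]four; ring.
  apply: qm_scale; rewrite ?invr_ge0//.
  by apply: QD; apply: QM => //; exact: sosQ.
by apply: properQ; rewrite e1; exact: QD.
Qed.

Hypothesis archQ : archimedean_module Q.

(** The value at [b] of the character that [Q] determines is the number [r] by
    which [b] is squeezed: both [b - r] and [r - b] are infinitesimally close to
    [Q]. *)
Let is_value b r :=
  forall e : R, 0 < e -> Q (b - r%:B + e%:B) /\ Q (r%:B - b + e%:B).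

Lemma maximal_valueP b : exists r, is_value b r.
Proof.
pose E := [set r | Q (b - r%:B)].
have E0 : E !=set0.
  have [r Qr] := archQ (- b).
  by exists (- r); rewrite /E /mkset rmorphN opprK addrC -[b]opprK.
have Eub : has_ubound E.
  have [r Qr] := archQ b.
  exists r => s Es; rewrite leNgt; apply/negP => rs.
  apply: properQ; apply: (@qm_neg_scalar _ (r - s)) => //; first lra.
  have -> : (r - s)%:B = (r%:B - b) + (b - s%:B) by ring.
  by case: qQ => _ QD _; exact: QD.
have hE : has_sup E by [].
exists (sup E) => e e0; split.
- have [x Ex xE] := sup_adherent e0 hE.
  have -> : b - (sup E)%:B + e%:B = b - x%:B + (x - (sup E - e))%:B by ring.
  by apply: qm_addr => //; lra.
- have -> : (sup E)%:B - b + e%:B = - (b - (sup E + e)%:B) by ring.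
  have [/(ub_le_sup Eub)|//] := maximal_total (b - (sup E + e)%:B).
  by lra.
Qed.

Lemma maximal_value_uniq b r (s : R) : is_value b r -> is_value b s -> r = s.
Proof.
move=> vr vs.
wlog rs : r s vr vs / r < s.
  by move=> H; case: (ltgtP r s) => // [/H|/H h]; [exact|exact/esym/h].
exfalso; apply: properQ; have e0 : 0 < (s - r) / 4 by lra.
have [_ Qr] := vr _ e0; have [Qs _] := vs _ e0.
apply: (@qm_neg_scalar _ (r - s + ((s - r) / 4 + (s - r) / 4))) => //; first lra.
have -> : (r - s + ((s - r) / 4 + (s - r) / 4))%:B =
  (r%:B - b + ((s - r) / 4)%:B) + (b - s%:B + ((s - r) / 4)%:B).
  by ring.
by case: qQ => _ QD _; exact: QD.
Qed.

(** Additivity and homogeneity are immediate from the squeezing; multiplicativity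
    follows by polarization from the case of a square, which reduces to elements of
    value 0. *)
Lemma maximal_character : exists sigma, characters_on Q sigma.
Proof.
case: (qQ) => Q1 QD QM.
have /choice[sigma sigmaP] := maximal_valueP.
have sigmaE b r : is_value b r -> sigma b = r.
  exact: maximal_value_uniq.
have sigmaD b c : sigma (b + c) = sigma b + sigma c.
  apply: sigmaE => e e0; have e2 : 0 < e / 2 by lra.
  have [Qb1 Qb2] := sigmaP b _ e2; have [Qc1 Qc2] := sigmaP c _ e2.
  have ee : e%:B = (e / 2)%:B + (e / 2)%:B by rewrite -rmorphD/=; congr (_%:B); lra.
  split.
  - by have := QD _ _ Qb1 Qc1; congr Q; rewrite ee; ring.
  - by have := QD _ _ Qb2 Qc2; congr Q; rewrite ee; ring.
have sigmaC r : sigma r%:B = r.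
  apply: sigmaE => e e0; rewrite subrr add0r.
  by split; apply: qm_scalar => //; exact: ltW.
have sigma1 : sigma 1 = 1 by rewrite -(rmorph1 (in_alg B)) sigmaC.
have sigma_ge0 b : Q b -> 0 <= sigma b.
  move=> Qb; rewrite leNgt; apply/negP => sb0; apply: properQ.
  have e0 : 0 < - sigma b / 2 by lra.
  have [_ Qe] := sigmaP b _ e0.
  apply: (@qm_neg_scalar _ (sigma b + - sigma b / 2)) => //; first lra.
  by have := QD _ _ Qb Qe; congr Q; ring.
have sigma0 : sigma 0 = 0 by rewrite -(rmorph0 (in_alg B)) sigmaC.
have sigmaN b : sigma (- b) = - sigma b.
  by apply/eqP; rewrite -addr_eq0 -sigmaD addNr sigma0.
have sigmaZp r b : 0 < r -> sigma (r%:B * b) = r * sigma b.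
  move=> r0; apply: sigmaE => e e0.
  have er0 : 0 < e / r by rewrite divr_gt0.
  have [Q2 Q3] := sigmaP b _ er0.
  have ee : e%:B = r%:B * (e / r)%:B.
    by rewrite -rmorphM/= mulrCA mulfV ?mulr1// gt_eqF.
  split.
  - by have := qm_scale qQ (ltW r0) Q2; congr Q; rewrite ee; ring.
  - by have := qm_scale qQ (ltW r0) Q3; congr Q; rewrite ee; ring.
have sigmaZ r b : sigma (r%:B * b) = r * sigma b.
  case: (ltgtP r 0) => [r0|/sigmaZp//|->]; last by rewrite rmorph0 !mul0r.
  rewrite -[r]opprK rmorphN mulNr sigmaN sigmaZp ?oppr_gt0//; ring.
(* For an element [c] of value 0 the upper bound of [c^2] comes from the identity
   [2 d (d^2 - c^2) = (d - c)^2 (d + c) + (d + c)^2 (d - c)]. *)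
have sigma_sq0 c : sigma c = 0 -> sigma (c * c) = 0.
  move=> c0; apply/eqP; rewrite eq_le; apply/andP; split; last first.
    by apply: sigma_ge0; rewrite -[X in Q X]mulr1; exact: QM.
  apply/ler_addgt0Pl => e e0; rewrite addr0.
  pose d := Num.sqrt e.
  have d0 : 0 < d by rewrite sqrtr_gt0.
  have dd : d * d = e by rewrite -expr2 sqr_sqrtr// ltW.
  have [] := sigmaP c _ d0; rewrite c0 rmorph0 subr0 sub0r => Q2 Q3.
  have Q4 := QM (d%:B - c) _ Q2.
  have Q5 := QM (d%:B + c) _ Q3.
  have := sigma_ge0 _ (QD _ _ Q4 Q5).
  have -> : (d%:B - c) * (d%:B - c) * (c + d%:B) + (d%:B + c) * (d%:B + c) * (- c + d%:B)
    = (2 * d)%:B * ((d * d)%:B - c * c).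
    ring.
  by rewrite sigmaZ sigmaD sigmaN sigmaC dd pmulr_rge0 ?subr_ge0// mulr_gt0.
have sigma_sq c : sigma (c * c) = sigma c * sigma c.
  have := sigma_sq0 (c - (sigma c)%:B).
  rewrite sigmaD sigmaN sigmaC subrr => /(_ erefl).
  have -> : (c - (sigma c)%:B) * (c - (sigma c)%:B) =
    c * c + - ((2 * sigma c)%:B * c) + (sigma c * sigma c)%:B.
    by ring.
  by rewrite !sigmaD sigmaN sigmaZ sigmaC; lra.
exists sigma; split=> //.
- by move=> r b c; rewrite sigmaD -[r *: b]mulr_algl -[_%:A]/(r%:B) sigmaZ.
- move=> b c; have := sigma_sq (b + c).
  have -> : (b + c) * (b + c) = b * b + c * c + 2%:B * (b * c).
    by ring.
  by rewrite !sigmaD sigmaZ !sigma_sq; lra.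
Qed.

End maximal.

Lemma exists_maximal M : quadratic_module M -> ~ M (-1) ->
  exists Q, [/\ quadratic_module Q, ~ Q (-1), M `<=` Q &
    forall Q', quadratic_module Q' -> ~ Q' (-1) -> Q `<=` Q' -> Q' = Q].
Proof.
move=> qM MN1.
(* The empty set is admitted as the union of the empty chain. *)
pose P X := X = set0 \/ [/\ quadratic_module X, ~ X (-1) & M `<=` X].
have [F FP Ftot|Q [PQ Qmax]] := @Zorn_bigcup _ P.
  have [[X0 FX0 X0M]|H] := pselect (exists2 X, F X & X <> set0); last first.
    left; apply/seteqP; split=> // x [X FX Xx].
    by apply: H; exists X => // X0; rewrite X0 in Xx.
  right; split.
  - split.
    + exists X0 => //; have [//|[[]//]] := FP _ FX0.
    + move=> b c [X FX Xb] [Y FY Yc].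
      wlog XY : b c X Y FX FY Xb Yc / X `<=` Y.
        move=> H; have [XY|YX] := Ftot _ _ FX FY; first exact: (H b c X Y).
        by rewrite addrC; exact: (H c b Y X).
      exists Y => //; have [Y0|[[_ YD _] _ _]] := FP _ FY; first by rewrite Y0 in Yc.
      by apply: YD => //; exact: XY.
    + move=> c b [X FX Xb]; exists X => //.
      have [X00|[[_ _ XM] _ _]] := FP _ FX; first by rewrite X00 in Xb.
      exact: XM.
  - move=> [X FX X1]; have [X00|[_ /(_ X1)//]] := FP _ FX.
    by rewrite X00 in X1.
  - move=> x Mx; exists X0 => //; have [//|[_ _]] := FP _ FX0; exact.
have M1 : M 1 by case: qM.
have {PQ} [Q0|[qQ QN1 MQ]] := PQ.
  exfalso; apply: (Qmax M); last by right; split.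
  by rewrite Q0; split => // /(_ _ M1).
exists Q; split=> // Q' qQ' Q'N1 QQ'.
apply/eqP; apply/negPn/negP => /eqP QQ'N; apply: (Qmax Q').
  by split=> // Q'Q; apply: QQ'N; exact/seteqP.
by right; split=> // x /MQ; exact: QQ'.
Qed.

(** If [M - S f] is proper, where [S] is the set of sums of squares, then a maximal
    module above it yields a character that is nonpositive at [f]. Otherwise
    [s f - 1] lies in [M] for some [s] in [S]; this allows one to lower the constant
    [r] in [f + r] by a fixed amount without leaving [M], until [r] is at most 0. *)
Theorem positivstellensatz M f : quadratic_module M -> archimedean_module M ->
  (forall sigma, characters_on M sigma -> 0 < sigma f) -> M f.
Proof.
move=> qM archM fpos; case: (qM) => M1 MD MM.
have [qN MN NNf] := adjoin_qmP (- f) qM.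
have [[m [s [Mm Ss e]]]|NN1] := pselect (adjoin_qm M (- f) (-1)); last first.
  have [Q [qQ QN1 NQ Qmax]] := exists_maximal qN NN1.
  have archQ : archimedean_module Q.
    by move=> b; have [r Mr] := archM b; exists r; exact/NQ/MN.
  have [sigma [sZ sM s1 sQ]] := maximal_character qQ QN1 Qmax archQ.
  have := sQ _ (NQ _ NNf); have [_ _ -> _] := scalar_morph sZ.
  suff /fpos : characters_on M sigma by lra.
  by split=> // b /MN/NQ; exact: sQ.
have Msf : M (s * f - 1).
  have -> // : s * f - 1 = m by rewrite e; ring.
(* The two conditions on [k] are those that the identity below calls for. *)
have [k [k1 Mk Mkf]] : exists k : R,
    [/\ 1 <= k, M (2%:B * k%:B - s) & M (2%:B * k%:B - 1 - s * s * f)].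
  have [r1 Mr1] := archM s; have [r2 Mr2] := archM (s * s * f).
  pose k := 1 + `|r1| + `|r2|.
  have [r1l r2l] := (ler_norm r1, ler_norm r2).
  have [r1p r2p] := (normr_ge0 r1, normr_ge0 r2).
  exists k; split; first by rewrite /k; lra.
  - have -> : 2%:B * k%:B - s = r1%:B - s + (2 * k - r1)%:B by ring.
    by apply: qm_addr => //; rewrite /k; lra.
  - have -> : 2%:B * k%:B - 1 - s * s * f =
        r2%:B - s * s * f + (2 * k - 1 - r2)%:B by ring.
    by apply: qm_addr => //; rewrite /k; lra.
pose d := (k * k)^-1.
have k0 : 0 < k by lra.
have d0 : 0 < d by rewrite invr_gt0 mulr_gt0.
have step r : 0 <= r -> M (f + r%:B) -> M (f + (r - d)%:B).
  move=> r0 Mfr.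
  have dk : d%:B * (k%:B * k%:B) = 1.
    by rewrite -!rmorphM /d mulVf ?rmorph1// gt_eqF// mulr_gt0.
  have -> : f + (r - d)%:B = d%:B * (k%:B * k%:B * f + r%:B * (k%:B * k%:B) - 1).
    by rewrite -[LHS]mul1r -[X in X * _ = _]dk; ring: dk.
  apply: qm_scale => //; first exact: ltW.
  have -> : k%:B * k%:B * f + r%:B * (k%:B * k%:B) - 1 =
      (k%:B - s) * (k%:B - s) * (f + r%:B) + (2 * k)%:B * (s * f - 1)
      + r%:B * (s * (2%:B * k%:B - s)) + (2%:B * k%:B - 1 - s * s * f) by ring.
  apply: (MD) => //; apply: (MD); first apply: (MD).
  - exact: MM.
  - by apply: qm_scale => //; lra.
  - by apply: qm_scale => //; exact: qm_sosM.
have fin r : r <= 0 -> M (f + r%:B) -> M f.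
  move=> r0 Mr; have -> : f = f + r%:B + (- r)%:B by ring.
  by apply: qm_addr => //; lra.
have [r0 Mr0] := archM (- f).
have {}Mr0 : M (f + r0%:B) by have -> : f + r0%:B = r0%:B - - f by ring.
have iter_step n : M f \/ M (f + (r0 - n%:R * d)%:B).
  elim: n => [|n [|IH]]; [|by left|].
    by right; rewrite mul0r subr0.
  have [h|h] := leP (r0 - n%:R * d) 0; first by left; exact: fin IH.
  right; have -> : r0 - n.+1%:R * d = r0 - n%:R * d - d by rewrite -natr1; ring.
  by apply: step => //; exact: ltW.
have /archi_boundP : 0 <= `|r0| / d by rewrite divr_ge0// ltW.
set n := Num.bound _; rewrite ltr_pdivrMr// => nr0.
have [//|] := iter_step n; apply: fin; have := ler_norm r0; lra.
Qed.

End quadratic_modules.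

Section positive_functionals.
Context {R : realType} {B : comAlgType R}.
Variable phi : B -> R.
Hypotheses (phiL : scalar phi) (phi_sq : forall b, 0 <= phi (b * b)).
Hypothesis phi_bounded : forall b, exists r, forall c,
  phi (c * c * b) <= r * phi (c * c).

(** The elements that are nonnegative on the support of the measure that is to
    represent [phi]. *)
Definition support_module : set B := [set b | forall c, 0 <= phi (c * c * b)].

Lemma support_module_quadratic : quadratic_module support_module.
Proof.
split=> [c|b c Hb Hc d|b c Hc d]; rewrite /support_module/=.
- by rewrite mulr1.
- by rewrite mulrDr -[_ * b]scale1r phiL mul1r addr_ge0.
- have -> : d * d * (b * b * c) = (d * b) * (d * b) * c by ring.
  exact: Hc.
Qed.

Lemma support_module_archimedean : archimedean_module support_module.
Proof.
move=> b; have [r Hr] := phi_bounded b; exists r => c /=.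
have [_ phiD phiN phiZ] := scalar_morph phiL.
by rewrite mulrBr -scalerAr mulr1 phiD phiN phiZ subr_ge0.
Qed.

(** Up to an arbitrarily small positive constant, an element that is nonnegative
    at the characters lies in the support module, by the Positivstellensatz. *)
Lemma positive_on_characters f :
  (forall sigma, characters_on support_module sigma -> 0 <= sigma f) ->
  0 <= phi f.
Proof.
move=> fpos; have [_ phiD _ phiZ] := scalar_morph phiL.
apply/ler_addgt0Pl => e e0.
have phi1 : 0 <= phi 1 by rewrite -[1]mulr1.
pose d := e / (phi 1 + 1).
have d0 : 0 < d by rewrite divr_gt0//; lra.
have : support_module (f + d%:A).
  apply: positivstellensatz => [||sigma sM].
  - exact: support_module_quadratic.
  - exact: support_module_archimedean.
  - have f0 := fpos _ sM; case: sM => /scalar_morph[_ sD _ sZ] _ s1 _.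
    by rewrite sD sZ s1 mulr1; lra.
move=> /(_ 1); rewrite !mul1r phiD phiZ => /le_trans; apply.
rewrite addrC lerD2r /d -mulrA ler_piMr//; first exact: ltW.
by rewrite ler_pdivrMl; lra.
Qed.

End positive_functionals.

(** * Uniform closures of function algebras *)

Section function_algebras.
Context {R : realType} {X : Type}.
Implicit Types (S : set (X -> R)) (f g : X -> R).

Definition function_algebra S :=
  [/\ forall r, S (fun=> r), forall f g, S f -> S g -> S (fun x => f x + g x),
      forall f g, S f -> S g -> S (fun x => f x * g x)
    & forall f, S f -> exists M : R, forall x, `|f x| <= M].

Definition uniform_closure S : set (X -> R) :=
  [set f | forall e : R, 0 < e -> exists2 g, S g & forall x, `|f x - g x| <= e].

Lemma sub_uniform_closure S : S `<=` uniform_closure S.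
Proof. by move=> f Sf e e0; exists f => // x; rewrite subrr normr0 ltW. Qed.

Lemma uniform_closure_closed S :
  uniform_closure (uniform_closure S) `<=` uniform_closure S.
Proof.
move=> f Sf e e0; have e2 : 0 < e / 2 by lra.
have [g Sg fg] := Sf _ e2; have [h Sh gh] := Sg _ e2.
exists h => // x; have := fg x; have := gh x.
have := ler_normD (f x - g x) (g x - h x).
have -> : f x - g x + (g x - h x) = f x - h x by ring.
lra.
Qed.

Lemma function_algebraZ S r f : function_algebra S -> S f ->
  S (fun x => r * f x).
Proof. by move=> [SC SD SM _] Sf; apply: (SM) => //; exact: SC. Qed.

Lemma function_algebra_closure S :
  function_algebra S -> function_algebra (uniform_closure S).
Proof.
move=> aS; case: (aS) => SC SD SM SB; split.
- by move=> r; apply: sub_uniform_closure; exact: SC.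
- move=> f g Sf Sg e e0; have e2 : 0 < e / 2 by lra.
  have [f' Sf' ff'] := Sf _ e2; have [g' Sg' gg'] := Sg _ e2.
  exists (fun x => f' x + g' x); first exact: (SD).
  move=> x; have := ff' x; have := gg' x.
  have := ler_normD (f x - f' x) (g x - g' x).
  have -> : f x - f' x + (g x - g' x) = f x + g x - (f' x + g' x) by ring.
  lra.
- move=> f g Sf Sg e e0.
  have [f1 Sf1 ff1] := Sf _ (@ltr01 R).
  have [Mf f1b] := SB _ Sf1.
  pose M := `|Mf| + 1.
  have M0 : 0 < M by rewrite /M; have := normr_ge0 Mf; lra.
  have fM x : `|f x| <= M.
    have := ff1 x; have := f1b x; have := ler_norm Mf; rewrite /M.
    have := ler_normD (f x - f1 x) (f1 x); rewrite subrK; lra.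
  have [g' Sg' gg'] := Sg _ (divr_gt0 (divr_gt0 e0 (@ltr0Sn R 1)) M0).
  have [N0 g'b] := SB _ Sg'.
  pose N := `|N0| + 1.
  have N1 : 0 < N by rewrite /N; have := normr_ge0 N0; lra.
  have g'N x : `|g' x| <= N by have := g'b x; have := ler_norm N0; rewrite /N; lra.
  have [f' Sf' ff'] := Sf _ (divr_gt0 (divr_gt0 e0 (@ltr0Sn R 1)) N1).
  exists (fun x => f' x * g' x); first exact: (SM).
  move=> x.
  have -> : f x * g x - f' x * g' x = f x * (g x - g' x) + (f x - f' x) * g' x.
    by ring.
  apply: (le_trans (ler_normD _ _)); rewrite !normrM.
  rewrite -[leRHS](_ : e / 2 + e / 2 = _); last lra.
  apply: lerD.
  + rewrite -[leRHS](@mulfVK _ M) ?gt_eqF// mulrC.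
    by apply: ler_pM => //; exact: gg'.
  + rewrite -[leRHS](@mulfVK _ N) ?gt_eqF//.
    by apply: ler_pM => //; exact: ff'.
- move=> f Sf; have [g Sg fg] := Sf _ (@ltr01 R); have [M gM] := SB _ Sg.
  exists (M + 1) => x; have := fg x; have := gM x.
  have := ler_normD (f x - g x) (g x); rewrite subrK; lra.
Qed.

(** These polynomials in [u^2] increase to [|u|] uniformly for [|u| <= 1], since
    each step multiplies the error by [1 - (|u| + t) / 2]. *)
Fixpoint abs_approx k (u : R) : R :=
  if k is k'.+1 then
    let t := abs_approx k' u in t + 2^-1 * (u * u - t * t)
  else 0.

Lemma abs_approxP k (u : R) : `|u| <= 1 ->
  [/\ 0 <= abs_approx k u, abs_approx k u <= `|u|
    & (`|u| - abs_approx k u) * (1 + k%:R * (`|u| / 2)) <= `|u|].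
Proof.
move=> u1; have u0 := normr_ge0 u.
have uu : u * u = `|u| * `|u| by rewrite -normrM ger0_norm// -expr2 sqr_ge0.
elim: k => [|k [t0 tu IH]] /=; first by rewrite lexx u0 mul0r addr0 subr0 mulr1.
rewrite uu; set v := `|u| in u1 u0 uu tu IH *; set t := abs_approx k u in t0 tu IH *.
have ineq (a b : R) : 0 <= a -> 0 <= b -> 0 <= a * b by exact: mulr_ge0.
have dtv := ineq (v - t) (v + t) ltac:(lra) ltac:(lra).
have dtv2 := ineq (v - t) (2 - v - t) ltac:(lra) ltac:(lra).
split; [nra|nra|].
apply: le_trans IH.
have k0 : 0 <= k%:R :> R by [].
rewrite -[k.+1%:R]natr1.
have -> : v - (t + 2^-1 * (v * v - t * t)) = (v - t) * (1 - (v + t) / 2) by field.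
rewrite -mulrA; apply: ler_wpM2l; first lra.
have h1 := ineq _ _ k0 u0; have h2 := ineq _ _ h1 u0; have h3 := ineq _ _ h1 t0.
have h4 := ineq _ _ u0 u0; have h5 := ineq _ _ u0 t0.
lra.
Qed.

Lemma uniform_closure_abs S f : function_algebra S ->
  uniform_closure S f -> uniform_closure S (fun x => `|f x|).
Proof.
move=> aS Sf; have aC := function_algebra_closure aS.
case: (aC) => CC CD CM CB.
apply: uniform_closure_closed => e e0.
have [M0 fM0] := CB _ Sf.
pose M := `|M0| + 1.
have M1 : 0 < M by rewrite /M; have := normr_ge0 M0; lra.
have fM x : `|M^-1 * f x| <= 1.
  rewrite normrM gtr0_norm ?invr_gt0// ler_pdivrMl// mulr1.
  by have := fM0 x; have := ler_norm M0; rewrite /M; lra.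
have Chx k : uniform_closure S (fun x => abs_approx k (M^-1 * f x)).
  elim: k => [|k IH] /=; first exact: CC.
  have Cf := function_algebraZ M^-1 aC Sf.
  apply: (CD) => //; apply: (function_algebraZ _ aC); apply: (CD); first exact: (CM).
  rewrite (_ : (fun _ => _) =
      fun x => - 1 * (abs_approx k (M^-1 * f x) * abs_approx k (M^-1 * f x))).
    by apply: (function_algebraZ _ aC); exact: (CM).
  by apply/funext => x; ring.
have : 0 <= 2 * M / e by rewrite divr_ge0 ?mulr_ge0// ltW.
move=> /archi_boundP; set k := Num.bound _; rewrite ltr_pdivrMr// => kM.
exists (fun x => M * abs_approx k (M^-1 * f x)); first exact: (function_algebraZ _ aC).
move=> x; have [t0 tu Htu] := abs_approxP k (fM x).
set t := abs_approx _ _ in t0 tu Htu *.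
have -> : `|f x| = M * `|M^-1 * f x|.
  by rewrite normrM gtr0_norm ?invr_gt0// mulrA mulfV ?mul1r// gt_eqF.
set v := `|M^-1 * _| in tu Htu *.
rewrite -mulrBr normrM (gtr0_norm M1) ger0_norm ?subr_ge0//.
have k0 : 0 < k%:R :> R.
  rewrite ltr0n lt0n; apply/eqP => k0; move: kM; rewrite k0 mul0r => kM.
  by have : 0 < 2 * M by []; lra.
have ktv : k%:R * (v - t) <= 2.
  have [v0|v0] := leP v 0.
    have -> : v - t = 0 by lra.
    by rewrite mulr0.
  by rewrite -(@ler_pM2r _ v)//; nra.
rewrite -(@ler_pM2l _ k%:R)//.
have : M * (k%:R * (v - t)) <= M * 2 by rewrite ler_pM2l.
nra.
Qed.

Lemma uniform_closure_max S f g : function_algebra S ->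
  uniform_closure S f -> uniform_closure S g ->
  uniform_closure S (fun x => Num.max (f x) (g x)).
Proof.
move=> aS Sf Sg; have aC := function_algebra_closure aS; case: (aC) => CC CD CM CB.
have Sfg : uniform_closure S (fun x => `|f x + - 1 * g x|).
  by apply: uniform_closure_abs => //; apply: (CD) => //; exact: (function_algebraZ _ aC).
have := function_algebraZ 2^-1 aC (CD _ _ (CD _ _ Sf Sg) Sfg).
congr (uniform_closure S _); apply/funext => x.
rewrite mulN1r; case: (leP (f x) (g x)) => [fg|gf].
  by rewrite ler0_norm ?subr_le0//; field.
by rewrite gtr0_norm ?subr_gt0//; field.
Qed.

Lemma uniform_closureB1 S f : function_algebra S -> uniform_closure S f ->
  uniform_closure S (fun x => 1 - f x).
Proof.
move=> aS Sf; have aC := function_algebra_closure aS; case: (aC) => CC CD CM CB.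
have := CD _ _ (CC 1) (function_algebraZ (- 1) aC Sf).
by congr (uniform_closure S _); apply/funext => x; rewrite mulN1r.
Qed.

Lemma uniform_closure_min S f g : function_algebra S ->
  uniform_closure S f -> uniform_closure S g ->
  uniform_closure S (fun x => Num.min (f x) (g x)).
Proof.
move=> aS Sf Sg.
have := uniform_closureB1 aS
  (uniform_closure_max aS (uniform_closureB1 aS Sf) (uniform_closureB1 aS Sg)).
congr (uniform_closure S _); apply/funext => x.
by case: (leP (f x) (g x)); case: (leP (1 - f x) (1 - g x)); lra.
Qed.

End function_algebras.

(** A property of subsets that passes to subsets and to finite unions holds for a
    compact set as soon as it holds locally: otherwise the complements of the
    sets with the property would generate a proper filter without cluster
    point. *)
Lemma compact_induction (T : topologicalType) (K : set T) (P : set (set T)) :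
  compact K -> P set0 -> (forall A B, A `<=` B -> P B -> P A) ->
  (forall A B, P A -> P B -> P (A `|` B)) ->
  (forall x, K x -> exists2 U, nbhs x U & P (U `&` K)) -> P K.
Proof.
move=> cK P0 PS PU Ploc; apply: contrapT => NPK.
pose F : set_system T := [set Y | P (K `\` Y)].
have FF : ProperFilter F.
  split; first by rewrite /F/= setD0.
  split.
  - by rewrite /F/= setDT.
  - by move=> Y Z FY FZ; rewrite /F/= setDIr; exact: PU.
  - by move=> Y Z YZ; apply: PS; exact: setDS.
have FK : F K by rewrite /F/= setDv.
have [x [Kx Fx]] := cK F FF FK.
have [U xU PUK] := Ploc _ Kx.
have [] : ~` U `&` U !=set0.
  by apply: Fx => //; rewrite /F/= setDE setCK setIC.
by move=> y [].
Qed.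

(** * Urysohn functions in a point separating algebra *)

Section separation.
Context {R : realType} {T : topologicalType} {X : Type}.
Variables (iota : T -> X) (S : set (X -> R)).
Hypotheses (aS : function_algebra S).
Hypothesis S_continuous : forall f, S f -> continuous (f \o iota).
Implicit Types (f g : X -> R) (K L : set T).

Lemma uniform_closure_continuous f : uniform_closure S f -> continuous (f \o iota).
Proof.
move=> Sf x; apply/cvgrPdist_lt => e e0.
have e3 : 0 < e / 3 by lra.
have [g Sg fg] := Sf _ e3.
have /cvgrPdist_lt /(_ _ e3) := @S_continuous _ Sg x.
apply: filterS => y /=; have := fg (iota x); have := fg (iota y).
rewrite !ltr_norml !ler_norml; lra.
Qed.

Let C := uniform_closure S.

Lemma separate_points f (p q : X) : C f -> f p != f q ->
  exists2 g, C g & 1 < g p /\ g q < 0.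
Proof.
move=> Cf fpq; have aC := function_algebra_closure aS; case: (aC) => CC CD CM CB.
exists (fun x => 3 / (f p - f q) * (f x + - f q) + -1).
  by apply: (CD) => //; apply: (function_algebraZ _ aC); exact: (CD).
split; last by rewrite subrr mulr0; lra.
by rewrite mulfVK ?subr_eq0//; lra.
Qed.

(** Maxima of finitely many separating functions keep their common sign on [P]. *)
Lemma separate_compact K (P : set X) : compact K ->
  (forall x, K x -> exists2 g, C g & 1 < g (iota x) /\ forall y, P y -> g y < 0) ->
  exists2 g, C g & (forall x, K x -> 1 < g (iota x)) /\ forall y, P y -> g y < 0.
Proof.
move=> cK KP; have [CC _ _ _] := function_algebra_closure aS.
pose Q A := exists2 g, C g & (forall x, A x -> 1 < g (iota x)) /\ forall y, P y -> g y < 0.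
suff : Q K by [].
apply: compact_induction => //.
- by exists (fun=> -1); [exact: CC|split=> // y _; lra].
- by move=> A B AB [g Cg [g1 g0]]; exists g => //; split=> // x /AB; exact: g1.
- move=> A B [f Cf [f1 f0]] [g Cg [g1 g0]].
  exists (fun x => Num.max (f x) (g x)); first exact: uniform_closure_max.
  split=> [x [Ax|Bx]|y Py]; rewrite ?lt_max ?gt_max.
  + by rewrite f1.
  + by rewrite g1// orbT.
  + by rewrite f0// g0.
- move=> x Kx; have [g Cg [g1 g0]] := KP _ Kx.
  exists [set y | 1 < (g \o iota) y].
    have : continuous (g \o iota) by exact: uniform_closure_continuous.
    by move=> /(_ x)/cvgr_gt; apply.
  by exists g => //; split=> // y [].
Qed.

(** The closure of the algebra is a lattice, so functions that separate pairs of
    points combine to one that separates compact sets: first over [L], then over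
    [K]. It is clipped to the unit interval and approximated in the algebra. The
    point [o] will be the point at infinity, about whose neighbourhoods the topology
    of [T] says nothing. *)
Lemma algebra_urysohn K L (o : X) (e : R) : compact K -> compact L ->
  K `&` L = set0 ->
  (forall x y, x <> y -> exists2 f, S f & f (iota x) != f (iota y)) ->
  (forall x, exists2 f, S f & f (iota x) != f o) -> 0 < e ->
  exists2 f, S f & [/\ forall x, 0 <= f x <= 1,
    forall x, K x -> 1 - e <= f (iota x), forall x, L x -> f (iota x) <= e
    & f o <= e].
Proof.
move=> cK cL KL sep sepo e0; have aC := function_algebra_closure aS.
case: (aC) => CC CD CM CB; case: (aS) => SC SD SM SB.
have [g Cg [g1 g0]] : exists2 g, C g & (forall x, K x -> 1 < g (iota x)) /\
    forall y, (iota @` L `|` [set o]) y -> g y < 0.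
  apply: separate_compact => // x Kx.
  have [h Ch [h1 h0]] : exists2 h, C h & (forall y, L y -> 1 < h (iota y)) /\
      forall y, [set iota x] y -> h y < 0.
    apply: separate_compact => // y Ly.
    have xy : y <> x.
      by move=> yx; rewrite -[False]/(set0 x) -KL; split=> //; rewrite -yx.
    have [f Sf fxy] := sep _ _ xy.
    have [h Ch [h1 h0]] := separate_points (sub_uniform_closure Sf) fxy.
    by exists h => //; split=> // _ ->.
  have [f Sf] := sepo x; rewrite eq_sym => fxo.
  have [k Ck [k1 k0]] := separate_points (sub_uniform_closure Sf) fxo.
  exists (fun y => 1 - Num.max (h y) (k y)).
    by apply: uniform_closureB1 => //; exact: uniform_closure_max.
  split; first by rewrite ltrBrDr gtrDl gt_max h0.
  by move=> y [[z Lz <-]|->]; rewrite subr_lt0 lt_max ?h1// k1 orbT.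
have C01 : C (fun x => Num.min 1 (Num.max 0 (g x))).
  by apply: uniform_closure_min => //; apply: uniform_closure_max.
pose d := e / 4.
have d0 : 0 < d by rewrite /d; lra.
have [f Sf gf] := C01 _ d0.
pose c := (1 + 2 * d)^-1.
exists (fun x => c * (f x + d)).
  by apply: (function_algebraZ _ aS); exact: (SD).
have D1 : 0 < 1 + 2 * d by lra.
have fb x : - d <= f x <= 1 + d.
  have : 0 <= Num.min 1 (Num.max 0 (g x)) <= 1.
    by rewrite le_min ge_min le_max !lexx ler01.
  by have := gf x; rewrite ler_norml; lra.
have fneg x : g x < 0 -> f x <= d.
  move=> gx; have := gf x; rewrite (@max_l _ R 0) ?(ltW gx)// min_r ?ler01//.
  by rewrite ler_norml; lra.
have fpos x : 1 < g x -> 1 - d <= f x.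
  move=> gx; have := gf x; rewrite (@max_r _ R 0) ?min_l ?ler_norml; lra.
have dE : e = 4 * d by rewrite /d; lra.
split=> [x|x Kx|x Lx|].
- by have := fb x => fbx; rewrite /c ler_pdivrMl// mulr1 mulr_ge0 ?invr_ge0; lra.
- by rewrite /c ler_pdivlMl//; have := fpos _ (g1 _ Kx); rewrite dE; nra.
- rewrite /c ler_pdivrMl//; have /fneg : g (iota x) < 0 by apply: g0; left; exists x.
  by rewrite dE; nra.
- rewrite /c ler_pdivrMl//; have /fneg : g o < 0 by apply: g0; right.
  by rewrite dE; nra.
Qed.

End separation.

(** * From contents on compact sets to inner regular measures *)

Section hausdorff_compact.
Context {T : topologicalType}.
Hypothesis hT : hausdorff_space T.
Implicit Types (K L U V : set T).

Lemma compact_setD K U : compact K -> open U -> compact (K `\` U).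
Proof.
move=> cK oU; apply: (subclosed_compact _ cK); last exact: subDsetl.
by rewrite setDE; apply: closedI; [exact: compact_closed|exact: open_closedC].
Qed.

Lemma hausdorff_separate_compact K L : compact K -> compact L ->
  K `&` L = set0 ->
  exists U V, [/\ open U, open V, K `<=` U, L `<=` V & U `&` V = set0].
Proof.
move=> cK cL KL.
have sep_point x : ~ L x ->
    exists U V, [/\ open U, open V, U x, L `<=` V & U `&` V = set0].
  move=> NLx.
  pose P A := exists U V, [/\ open U, open V, U x, A `<=` V & U `&` V = set0].
  suff : P L by [].
  apply: compact_induction => //.
  - by exists setT, set0; split=> //; [exact: openT|exact: open0|rewrite setI0].
  - move=> A B AB [U [V [oU oV Ux BV UV]]].
    by exists U, V; split=> //; exact: subset_trans BV.
  - move=> A B [U [V [oU oV Ux AV UV]]] [U' [V' [oU' oV' Ux' BV UV']]].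
    exists (U `&` U'), (V `|` V'); split=> //.
    + exact: openI.
    + exact: openU.
    + by apply: setUSS.
    + rewrite -subset0 => y [[Uy Uy'] [Vy|Vy]].
      * by rewrite -UV.
      * by rewrite -UV'.
  - move=> y Ly; have xy : x != y by apply/eqP => xy; apply: NLx; rewrite xy.
    move: hT; rewrite open_hausdorff => /(_ _ _ xy)[[U V]] /= [xU yV] [oU oV UV].
    exists V; first by apply: open_nbhs_nbhs; split=> //; exact: set_mem.
    exists U, V; split=> //; first exact: set_mem.
    exact/eqP.
pose P A := exists U V, [/\ open U, open V, A `<=` U, L `<=` V & U `&` V = set0].
suff : P K by [].
apply: compact_induction => //.
- by exists set0, setT; split=> //; [exact: open0|exact: openT|rewrite set0I].
- move=> A B AB [U [V [oU oV BU LV UV]]].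
  by exists U, V; split=> //; exact: subset_trans BU.
- move=> A B [U [V [oU oV AU LV UV]]] [U' [V' [oU' oV' BU LV' UV']]].
  exists (U `|` U'), (V `&` V'); split=> //.
  + exact: openU.
  + exact: openI.
  + by apply: setUSS.
  + by rewrite subsetI.
  + rewrite -subset0 => y [[Uy|Uy] [Vy Vy']].
    * by rewrite -UV.
    * by rewrite -UV'.
- move=> x Kx; have NLx : ~ L x by move=> Lx; rewrite -[False]/(set0 x) -KL.
  have [U [V [oU oV Ux LV UV]]] := sep_point _ NLx.
  exists U; first exact: open_nbhs_nbhs.
  by exists U, V; split=> // y [].
Qed.

(** The part of a compact set outside one of two open sets that cover it can be
    separated from the part outside the other one. *)
Lemma compact_split K U V : compact K -> open U -> open V -> K `<=` U `|` V ->
  exists K1 K2, [/\ compact K1, compact K2, K1 `<=` U, K2 `<=` V & K = K1 `|` K2].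
Proof.
move=> cK oU oV KUV.
have UV0 : (K `\` U) `&` (K `\` V) = set0.
  by rewrite -subset0 => x [[Kx NUx] [_ NVx]]; have [] := KUV _ Kx.
have [U' [V' [oU' oV' KU' KV' UV']]] :=
  hausdorff_separate_compact (compact_setD cK oU) (compact_setD cK oV) UV0.
exists (K `\` U'), (K `\` V'); split; [exact: compact_setD|exact: compact_setD| | |].
- by move=> x [Kx NU'x]; apply: contrapT => NUx; apply/NU'x/KU'.
- by move=> x [Kx NV'x]; apply: contrapT => NVx; apply/NV'x/KV'.
- by rewrite -setDIr UV' setD0.
Qed.

Lemma compact_bigcup K (U : (set T)^nat) : compact K -> (forall n, open (U n)) ->
  K `<=` \bigcup_n U n -> exists n, K `<=` \big[setU/set0]_(i < n) U i.
Proof.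
move=> cK oU KU.
pose P A := exists n, A `<=` \big[setU/set0]_(i < n) U i.
suff : P K by [].
apply: compact_induction => //.
- by exists 0%N.
- by move=> A B AB [n Bn]; exists n; exact: subset_trans Bn.
- move=> A B [n An] [m Bm]; exists (maxn n m) => x [Ax|Bx].
  + exact: (subset_bigsetU (leq_maxl n m)) (An _ Ax).
  + exact: (subset_bigsetU (leq_maxr n m)) (Bm _ Bx).
- move=> x Kx; have [n _ Unx] := KU _ Kx.
  exists (U n); first by apply: open_nbhs_nbhs; split.
  by exists n.+1 => y [Uny _]; rewrite big_ord_recr/=; right.
Qed.

End hausdorff_compact.

Section content.
Context {R : realType} {T : topologicalType}.
Hypothesis hT : hausdorff_space T.
Variable lam : set T -> R.
Hypotheses (lam_ge0 : forall K, compact K -> 0 <= lam K)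
  (lam_le1 : forall K, compact K -> lam K <= 1)
  (lam_sub : forall K L, compact K -> compact L ->
    lam (K `|` L) <= lam K + lam L)
  (lam_add : forall K L, compact K -> compact L -> K `&` L = set0 ->
    lam K + lam L <= lam (K `|` L)).
Local Open Scope ereal_scope.
Implicit Types (K L U V A : set T).

Definition inner_content U : \bar R :=
  ereal_sup [set (lam K)%:E | K in [set K | compact K /\ K `<=` U]].

Definition outer_content A : \bar R :=
  ereal_inf [set inner_content U | U in [set U | open U /\ A `<=` U]].

Local Notation inner := inner_content.
Local Notation outer := outer_content.

Lemma content_set0 : lam set0 = 0%R.
Proof.
have c0 := @compact0 T; have := lam_add c0 c0 (set0I _); have := lam_ge0 c0.
by rewrite set0U; lra.
Qed.

Lemma inner_content_ub K U : compact K -> K `<=` U -> (lam K)%:E <= inner U.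
Proof. by move=> cK KU; apply: ereal_sup_ubound; exists K. Qed.

Lemma inner_contentS U V : U `<=` V -> inner U <= inner V.
Proof.
move=> UV; apply: ereal_sup_le => _ [K [cK KU] <-].
by exists K => //; split=> //; exact: subset_trans UV.
Qed.

Lemma inner_content_ge0 U : 0 <= inner U.
Proof. by have := inner_content_ub compact0 (sub0set U); rewrite content_set0. Qed.

Lemma inner_content_le1 U : inner U <= 1.
Proof. by apply: ge_ereal_sup => _ [K [cK _] <-]; rewrite lee_fin lam_le1. Qed.

Lemma inner_contentU U V : open U -> open V -> inner (U `|` V) <= inner U + inner V.
Proof.
move=> oU oV; apply: ge_ereal_sup => _ [K [cK KUV] <-].
have [K1 [K2 [cK1 cK2 K1U K2V ->]]] := compact_split hT cK oU oV KUV.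
apply: (@le_trans _ _ ((lam K1)%:E + (lam K2)%:E)).
  by rewrite -EFinD lee_fin lam_sub.
by apply: leeD; exact: inner_content_ub.
Qed.

Lemma inner_content_bigcup (U : (set T)^nat) : (forall n, open (U n)) ->
  inner (\bigcup_n U n) <= \sum_(n <oo) inner (U n).
Proof.
move=> oU; apply: ge_ereal_sup => _ [K [cK KU] <-].
have [n Kn] := compact_bigcup cK oU KU.
apply: le_trans (inner_content_ub cK Kn) _.
apply: (@le_trans _ _ (\sum_(0 <= i < n) inner (U i))); last first.
  by apply: nneseries_lim_ge => *; exact: inner_content_ge0.
rewrite big_mkord; elim: n {Kn} => [|n IH].
  rewrite !big_ord0; apply: ge_ereal_sup => _ [L [_ L0] <-].
  by move: L0; rewrite subset0 => ->; rewrite content_set0.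
rewrite !big_ord_recr/=; apply: le_trans (leeD2r _ IH).
by apply: inner_contentU => //; rewrite -bigcup_mkord; apply: bigcup_open.
Qed.

Lemma outer_content_open U : open U -> outer U = inner U.
Proof.
move=> oU; apply/eqP; rewrite eq_le; apply/andP; split.
  by apply: ereal_inf_lbound; exists U => //; split.
by apply: le_ereal_inf_tmp => _ [V [oV UV] <-]; exact: inner_contentS.
Qed.

Lemma outer_content_ub A U : open U -> A `<=` U -> outer A <= inner U.
Proof. by move=> oU AU; apply: ereal_inf_lbound; exists U. Qed.

Lemma outer_content_ge0 A : 0 <= outer A.
Proof. by apply: le_ereal_inf_tmp => _ [V _ <-]; exact: inner_content_ge0. Qed.

Lemma outer_content_fin A : outer A \is a fin_num.
Proof.
rewrite ge0_fin_numE ?outer_content_ge0//; apply: le_lt_trans (ltry 1).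
by apply: le_trans (inner_content_le1 setT); apply: outer_content_ub => //; exact: openT.
Qed.

Lemma outer_content_adherent A (e : R) : (0 < e)%R ->
  exists U, [/\ open U, A `<=` U & inner U <= outer A + e%:E].
Proof.
move=> e0; have [_ [U [oU AU] <-] Ue] := lb_ereal_inf_adherent e0 (outer_content_fin A).
by exists U; split=> //; exact: ltW.
Qed.

Lemma outer_content0 : outer set0 = 0.
Proof.
rewrite outer_content_open; last exact: open0.
apply/eqP; rewrite eq_le inner_content_ge0 andbT.
apply: ge_ereal_sup => _ [L [_ L0] <-].
by move: L0; rewrite subset0 => ->; rewrite content_set0.
Qed.

Lemma outer_contentS : {homo outer : A B / A `<=` B >-> A <= B}.
Proof.
move=> A B AB; apply: le_ereal_inf_tmp => _ [V [oV BV] <-].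
by apply: outer_content_ub => //; exact: subset_trans BV.
Qed.

Lemma outer_content_sigma_subadditive : sigma_subadditive outer.
Proof.
move=> F; apply/lee_addgt0Pr => e e0.
have /choice[U HU] n : exists U, [/\ open U, F n `<=` U &
    inner U <= outer (F n) + (e / (2 ^ n.+1)%:R)%:E].
  by apply: outer_content_adherent; rewrite divr_gt0// ltr0n expn_gt0.
apply: (@le_trans _ _ (\sum_(n <oo) inner (U n))).
  apply: (@le_trans _ _ (inner (\bigcup_n U n))).
    apply: outer_content_ub; first by apply: bigcup_open => n _; have [] := HU n.
    by move=> x [n _ Fx]; exists n => //; have [_ + _] := HU n; apply.
  by apply: inner_content_bigcup => n; have [] := HU n.
apply: (@le_trans _ _ (\sum_(n <oo) (outer (F n) + (e / (2 ^ n.+1)%:R)%:E))).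
  apply: lee_nneseries => [n _ _|n _]; first exact: inner_content_ge0.
  by have [] := HU n.
by apply: epsilon_trick; [move=> n; exact: outer_content_ge0|exact: ltW].
Qed.

HB.instance Definition _ := isOuterMeasure.Build R T outer outer_content0
  outer_content_ge0 outer_contentS outer_content_sigma_subadditive.
(** If [K] nearly exhausts [W `&` U] from inside, a compact subset of [W `\` K]
    is disjoint from [K], whence the additivity over disjoint compact sets
    applies. *)
Lemma open_caratheodory U : open U -> outer.-caratheodory U.
Proof.
move=> oU; apply: le_caratheodory_measurable => X.
apply: le_ereal_inf_tmp => _ [W [oW XW] <-].
apply: (@le_trans _ _ (inner (W `&` U) + outer (W `&` ~` U))).
  apply: leeD; last by apply: outer_contentS; exact: setSI.
  by apply: outer_content_ub; [exact: openI|exact: setSI].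
have fo := outer_content_fin (W `&` ~` U).
rewrite -leeBrDr//; apply: ge_ereal_sup => _ [K [cK KWU] <-].
rewrite leeBrDr// addeC -leeBrDr//.
have oWK : open (W `\` K).
  by rewrite setDE; apply: openI => //; apply: closed_openC; exact: compact_closed.
apply: (@le_trans _ _ (inner (W `\` K))).
  apply: outer_content_ub => // x [Wx NUx]; split=> // /KWU[_ Ux]; exact: NUx.
apply: ge_ereal_sup => _ [L [cL LWK] <-].
rewrite leeBrDr//; apply: (@le_trans _ _ (lam (L `|` K))%:E).
  rewrite -EFinD lee_fin lam_add//; apply/seteqP; split=> // x [Lx Kx].
  by have [_] := LWK _ Lx; apply.
apply: inner_content_ub; first exact: compactU.
by move=> x [/LWK[]//|/KWU[]].
Qed.

Hypothesis lam_tight : forall e : R, (0 < e)%R ->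
  exists2 K, compact K & (1 - e <= lam K)%R.
Variable x : T.

Definition content_measure : set (borel x) -> \bar R := outer.

Let measurable_caratheodory (A : set (borel x)) :
  measurable A -> outer.-caratheodory A.
Proof.
apply: smallest_sub; last exact: open_caratheodory.
exact: (@sigma_algebra_measurable _ (caratheodory_type (outer : set (pointed_at x) -> _))).
Qed.

Let content_measure_sigma_additive : semi_sigma_additive content_measure.
Proof.
move=> F mF tF mUF.
apply: (@caratheodory_measure_sigma_additive R (pointed_at x) outer F) => //.
- by move=> n; exact: measurable_caratheodory.
- exact: measurable_caratheodory.
Qed.

HB.instance Definition _ := isMeasure.Build _ _ R content_measure
  outer_content0 outer_content_ge0 content_measure_sigma_additive.

Let content_measureT : content_measure setT = 1.
Proof.
rewrite /content_measure outer_content_open; last exact: openT.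
apply/eqP; rewrite eq_le inner_content_le1/=.
apply/lee_addgt0Pr => e e0; have [K cK Ke] := lam_tight e0.
rewrite -leeBlDr// -EFinB; apply: le_trans (inner_content_ub cK (@subsetT _ K)).
by rewrite lee_fin.
Qed.

HB.instance Definition _ :=
  Measure_isProbability.Build _ _ R content_measure content_measureT.

Hypothesis lam_regular : forall K (e : R), compact K -> (0 < e)%R ->
  exists U, [/\ open U, K `<=` U &
    forall L, compact L -> L `<=` U -> (lam L <= lam K + e)%R].

Lemma content_measure_compact K : compact K -> content_measure K = (lam K)%:E.
Proof.
move=> cK; apply/eqP; rewrite eq_le; apply/andP; split; last first.
  by apply: le_ereal_inf_tmp => _ [U [oU KU] <-]; exact: inner_content_ub.
apply/lee_addgt0Pr => e e0; have [U [oU KU HU]] := lam_regular cK e0.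
apply: le_trans (outer_content_ub oU KU) _.
by apply: ge_ereal_sup => _ [L [cL LU] <-]; rewrite -EFinD lee_fin; exact: HU.
Qed.

(** The complement of an open set that contains the complement of [B] and hardly
    exceeds it is a closed subset of [B]; tightness then cuts it down to a compact
    one. *)
Lemma content_measure_inner_regular : inner_regular content_measure.
Proof.
move=> B mB; apply/eqP; rewrite eq_le; apply/andP; split; last first.
  by apply: ge_ereal_sup => _ [K [cK KB] <-]; exact: outer_contentS.
apply/lee_addgt0Pr => e e0; have e2 : (0 < e / 2)%R by lra.
have [U [oU BU Ue]] := outer_content_adherent (~` B) e2.
have [K cK Ke] := lam_tight e2.
have mU : @measurable _ (borel x) U by exact: sub_sigma_algebra.
have mK : @measurable _ (borel x) K.
  rewrite -[K]setCK; apply: measurableC; apply: sub_sigma_algebra.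
  apply: closed_openC; exact: compact_closed.
have cKU : compact (K `\` U) by exact: compact_setD.
have mKU : @measurable _ (borel x) (K `\` U) by exact: measurableD.
apply: (@le_trans _ _ (content_measure (K `\` U) + e%:E)); last first.
  apply: leeD2r; apply: ereal_sup_ubound; exists (K `\` U) => //; split=> //.
  by move=> y [_ NUy]; apply: contrapT => NBy; apply/NUy/BU.
pose P : probability (borel x) R := content_measure.
have PB : P (~` B) = 1 - P B by exact: probability_setC.
have PK : P (~` K) = 1 - P K by exact: probability_setC.
have PU : P U <= P (~` B) + (e / 2)%:E.
  by apply: le_trans Ue; rewrite /P/= /content_measure outer_content_open.
have PK1 : (1 - e / 2)%:E <= P K.
  by rewrite /P/= content_measure_compact// lee_fin.
have : P setT <= P (K `\` U) + (P U + P (~` K)).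
  apply: (@le_trans _ _ (P ((K `\` U) `|` (U `|` ~` K)))).
    apply: le_measure; rewrite ?inE//.
      by do 2?apply: measurableU => //; exact: measurableC.
    by move=> y _; have [Ky|] := pselect (K y); have [Uy|] := pselect (U y);
      [right; left|left|right; right|right; right].
  apply: le_trans (outer_measureU2 _ _ _) _; apply: leeD2l.
  exact: outer_measureU2.
move: PU PK1; rewrite PB PK probability_setT.
change (content_measure B) with (P B).
change (content_measure (K `\` U)) with (P (K `\` U)).
have fin (A : set (borel x)) : measurable A -> exists r, P A = r%:E.
  by move=> mA; exists (fine (P A)); rewrite fineK// fin_num_measure.
have [[b ->] [u ->]] := (fin _ mB, fin _ mU).
have [[k ->] [c ->]] := (fin _ mK, fin _ mKU).
by rewrite -!EFinB -!EFinD !lee_fin; lra.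
Qed.

Lemma content_M1 : exists mu : M1 R T,
  forall K, compact K -> M1_prob mu K = (lam K)%:E.
Proof.
by exists (BuildM1 content_measure_inner_regular) => K; exact: content_measure_compact.
Qed.

End content.

(** Regularity, the last assumption, makes the outer measure of a compact set equal
    to its content. *)
Theorem content_representation (R : realType) (T : topologicalType)
    (lam : set T -> R) : hausdorff_space T ->
  (forall K, compact K -> 0 <= lam K) ->
  (forall K, compact K -> lam K <= 1) ->
  (forall K L, compact K -> compact L -> lam (K `|` L) <= lam K + lam L) ->
  (forall K L, compact K -> compact L -> K `&` L = set0 ->
    lam K + lam L <= lam (K `|` L)) ->
  (forall e, 0 < e -> exists2 K, compact K & 1 - e <= lam K) ->
  (forall K e, compact K -> 0 < e -> exists U, [/\ open U, K `<=` U &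
    forall L, compact L -> L `<=` U -> lam L <= lam K + e]) ->
  exists mu : M1 R T, forall K, compact K -> M1_prob mu K = (lam K)%:E.
Proof.
move=> hT lam_ge0 lam_le1 lam_sub lam_add lam_tight lam_regular.
have [K0 cK0 K0e] := lam_tight 2^-1 ltac:(lra).
have [x _] : K0 !=set0.
  apply/set0P/eqP => K00; move: K0e; rewrite K00 (content_set0 lam_ge0 lam_add); lra.
exact: (content_M1 hT).
Qed.

(** * The unitization of the selfadjoint part *)

Section complex_facts.
Context {R : realType}.
Implicit Types z w : R[i].

Lemma conjE z : z^*%R = conjc z. Proof. by []. Qed.

Lemma conj_i : ('i : R[i])^*%R = - 'i.
Proof. by rewrite conjE /conjc; congr (_ +i* _); rewrite oppr0. Qed.

Lemma ReD z w : complex.Re (z + w) = complex.Re z + complex.Re w.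
Proof. by case: z => a b; case: w. Qed.

Lemma ImD z w : complex.Im (z + w) = complex.Im z + complex.Im w.
Proof. by case: z => a b; case: w. Qed.

Lemma Re_mulrC (r : R) z : complex.Re (r%:C * z) = r * complex.Re z.
Proof. by case: z => a b /=; rewrite mul0r subr0. Qed.

Lemma Im_mulrC (r : R) z : complex.Im (r%:C * z) = r * complex.Im z.
Proof. by case: z => a b /=; rewrite mul0r addr0. Qed.

Lemma normc_Re z : `|complex.Re z|%:C <= `|z|.
Proof. by rewrite normc_def lecR -sqrtr_sqr ler_wsqrtr// lerDl sqr_ge0. Qed.

Lemma complex_ReM z w : complex.Re (z * w) =
  complex.Re z * complex.Re w - complex.Im z * complex.Im w.
Proof. by case: z => a b; case: w. Qed.

Lemma complex_ImM z w : complex.Im (z * w) =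
  complex.Re z * complex.Im w + complex.Im z * complex.Re w.
Proof. by case: z => a b; case: w. Qed.
End complex_facts.

Section selfadjoint_part.
Context {R : realType} {A : normedStarAlgType R}.
Implicit Types (a b : A) (k : R[i]).

Lemma star0 : star (0 : A) = 0.
Proof. by have := starZ 0 (0 : A); rewrite scale0r rmorph0 scale0r. Qed.

Lemma starN a : star (- a) = - star a.
Proof. by rewrite -scaleN1r starZ rmorphN rmorph1 scaleN1r. Qed.

Lemma starB a b : star (a - b) = star a - star b.
Proof. by rewrite starD starN. Qed.

Lemma amul0r b : amul 0 b = 0 :> A.
Proof. by have := amulZl 0 (0 : A) b; rewrite !scale0r. Qed.

Lemma amulr0 b : amul b 0 = 0 :> A.
Proof. by have := amulZr 0 b (0 : A); rewrite !scale0r. Qed.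

Definition sa_pred : {pred A} := fun a => star a == a.

Lemma sa_predP a : reflect (selfadjoint a) (a \in sa_pred).
Proof. exact: eqP. Qed.

Lemma sa_zmod_closed : zmod_closed sa_pred.
Proof.
split=> [|a b]; first by apply/sa_predP; exact: star0.
by move=> /sa_predP sa /sa_predP sb; apply/sa_predP; rewrite /selfadjoint/= starB sa sb.
Qed.

HB.instance Definition _ := GRing.isZmodClosed.Build A sa_pred sa_zmod_closed.

Lemma saZ (r : R) a : selfadjoint a -> selfadjoint (r%:C *: a).
Proof. by move=> sa; rewrite /selfadjoint/= starZ sa conjE conjc_real. Qed.

Lemma scale_half_double a : (2^-1)%:C *: (a + a) = a.
Proof.
rewrite -[a + a]mulr2n -[a *+ 2]scaler_nat scalerA.
by rewrite -(rmorph_nat (real_complex R)) -rmorphM mulVf ?pnatr_eq0// rmorph1 scale1r.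
Qed.

Definition re_part a : A := (2^-1)%:C *: (a + star a).
Definition im_part a : A := (- 'i * (2^-1)%:C) *: (a - star a).

Lemma re_part_sa a : selfadjoint (re_part a).
Proof. by apply: saZ; rewrite /selfadjoint/= starD starK addrC. Qed.

Lemma im_part_sa a : selfadjoint (im_part a).
Proof.
rewrite /selfadjoint/= /im_part starZ starB starK -opprB scalerN -scaleNr.
by congr (_ *: _); rewrite conjE rmorphM rmorphN; simpc.
Qed.


Lemma re_im_part a : a = re_part a + 'i *: im_part a.
Proof.
rewrite /re_part /im_part scalerA.
have -> : 'i * (- 'i * (2^-1)%:C) = (2^-1)%:C :> R[i].
  by rewrite mulrA mulrN -expr2 sqr_i opprK mul1r.
by rewrite -scalerDr addrACA subrr addr0 scale_half_double.
Qed.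

End selfadjoint_part.

Record sa_part {R : realType} (A : normedStarAlgType R) :=
  SaPart { sa_val :> A; sa_valP : sa_val \in sa_pred }.

Section sa_part_lmodule.
Context {R : realType} {A : normedStarAlgType R}.

HB.instance Definition _ := [isSub for @sa_val R A].
HB.instance Definition _ := [Choice of sa_part A by <:].
HB.instance Definition _ := [SubChoice_isSubZmodule of sa_part A by <:].

Definition sa_mk (a : A) (sa : selfadjoint a) : sa_part A :=
  SaPart (introT (sa_predP a) sa).

Lemma sa_partP (a : sa_part A) : selfadjoint (a : A).
Proof. exact/sa_predP/sa_valP. Qed.

Definition sa_scale (r : R) (a : sa_part A) := sa_mk (saZ r (sa_partP a)).

Lemma sa_scaleA r s a : sa_scale r (sa_scale s a) = sa_scale (r * s) a.
Proof. by apply/val_inj; rewrite /= scalerA -rmorphM. Qed.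

Lemma sa_scale1 : left_id 1 sa_scale.
Proof. by move=> a; apply/val_inj; rewrite /= rmorph1 scale1r. Qed.

Lemma sa_scaleDr : right_distributive sa_scale +%R.
Proof. by move=> r a b; apply/val_inj; rewrite /= scalerDr. Qed.

Lemma sa_scaleDl a : {morph sa_scale^~ a : r s / r + s}.
Proof. by move=> r s; apply/val_inj; rewrite /= rmorphD scalerDl. Qed.

HB.instance Definition _ := GRing.Zmodule_isLmodule.Build R (sa_part A)
  sa_scaleA sa_scale1 sa_scaleDr sa_scaleDl.

End sa_part_lmodule.

(** The pair [(a, r)] stands for [a + r 1]. The commutativity of [A] is recorded in
    the type, since the ring structure depends on it. *)
Definition unitization {R : realType} {A : normedStarAlgType R}
  (amulC : commutative (@amul R A)) : Type := (sa_part A * R^o)%type.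

Section unitization_algebra.
Context {R : realType} {A : normedStarAlgType R}.
Variable amulC : commutative (@amul R A).
Local Notation B := (unitization amulC).

HB.instance Definition _ := GRing.Lmodule.copy B (sa_part A * R^o)%type.

Lemma amul_sa (a b : A) : selfadjoint a -> selfadjoint b -> selfadjoint (amul a b).
Proof. by move=> sa sb; rewrite /selfadjoint/= starM sa sb amulC. Qed.

Definition sa_mul (a b : sa_part A) : sa_part A :=
  sa_mk (amul_sa (sa_partP a) (sa_partP b)).

Definition unit_mul (x y : B) : B :=
  (sa_mul x.1 y.1 + (x.2 *: y.1 + y.2 *: x.1), x.2 * y.2).

Definition unit_one : B := (0, 1).

Lemma sa_mulC : commutative sa_mul.
Proof. by move=> a b; apply/val_inj; exact: amulC. Qed.

Lemma sa_mulA : associative sa_mul.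
Proof. by move=> a b c; apply/val_inj; exact: amulA. Qed.

Lemma sa_mulDl : left_distributive sa_mul +%R.
Proof. by move=> a b c; apply/val_inj; exact: amulDl. Qed.

Lemma sa_mulZl (r : R) a b : sa_mul (r *: a) b = r *: sa_mul a b.
Proof. by apply/val_inj; exact: amulZl. Qed.

Lemma sa_mul0 a : sa_mul 0 a = 0.
Proof. by apply/val_inj; exact: amul0r. Qed.

Lemma unit_mulC : commutative unit_mul.
Proof.
by move=> x y; rewrite /unit_mul sa_mulC mulrC [x.2 *: _ + _]addrC.
Qed.

Lemma sa_mulDr : right_distributive sa_mul +%R.
Proof. by move=> a b c; rewrite sa_mulC sa_mulDl !(sa_mulC a). Qed.

Lemma sa_mulZr (r : R) a b : sa_mul a (r *: b) = r *: sa_mul a b.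
Proof. by rewrite sa_mulC sa_mulZl sa_mulC. Qed.

Lemma unit_mulA : associative unit_mul.
Proof.
move=> [a r] [b s] [c t]; rewrite /unit_mul/=; congr pair; last exact: mulrA.
rewrite !sa_mulDr !sa_mulDl !sa_mulZr !sa_mulZl sa_mulA !scalerDr !scalerA.
rewrite -!addrA; congr (_ + _).
rewrite [r * t]mulrC [t * s]mulrC.
set u1 := s *: _; set u2 := t *: _; set u3 := r *: _; set u4 := (r * s) *: _.
set u5 := (t * r) *: _; set u6 := (s * t) *: _.
by rewrite [RHS]addrCA (addrCA u4 u2) (addrCA u3 u2).
Qed.

Lemma unit_mul1 : left_id unit_one unit_mul.
Proof.
move=> [a r]; rewrite /unit_mul/= sa_mul0 scale1r scaler0 addr0 add0r.
by rewrite mul1r.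
Qed.

Lemma unit_mulDl : left_distributive unit_mul +%R.
Proof.
move=> [a r] [b s] [c t]; rewrite /unit_mul/=; congr pair; last exact: mulrDl.
rewrite /= sa_mulDl scalerDl scalerDr [RHS]addrACA; congr (_ + _); exact: addrACA.
Qed.

Lemma unit_one_neq0 : unit_one != 0.
Proof. by apply/eqP => -[] /eqP; rewrite oner_eq0. Qed.

HB.instance Definition _ := GRing.Zmodule_isComNzRing.Build B
  unit_mulA unit_mulC unit_mul1 unit_mulDl unit_one_neq0.

Lemma unit_scaleAl (r : R) (x y : B) : r *: (x * y) = (r *: x) * y.
Proof.
congr pair; last exact: mulrA.
rewrite /= sa_mulZl !scalerDr !scalerA; congr (_ + (_ + _ *: _)).
by rewrite mulrC.
Qed.

HB.instance Definition _ := GRing.Lmodule_isLalgebra.Build R B unit_scaleAl.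
HB.instance Definition _ := GRing.Lalgebra_isComAlgebra.Build R B.

Definition unit_in (a : sa_part A) : B := (a, 0).

End unitization_algebra.

(** If the sequence starts at [1 + d] with [d > 0], then each term exceeds its
    predecessor by at least [d]. *)
Lemma squaring_bounded (R : realType) (x : nat -> R) (C : R) :
  (forall n, x n * x n <= x n.+1) -> (forall n, x n.+2 <= C) -> x 0%N <= 1.
Proof.
move=> xS xC; rewrite leNgt; apply/negP => x1.
pose d := x 0%N - 1.
have d0 : 0 < d by rewrite /d; lra.
have xlow n : 1 + d <= x n /\ 1 + n%:R * d <= x n.
  elim: n => [|n [IH1 IH2]]; first by rewrite mul0r /d; split; lra.
  rewrite -[n.+1%:R]natr1 mulrDl mul1r; have := xS n.
  have h : 0 <= x n - 1 - d by lra.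
  have := mulr_ge0 h (ltW d0); have := mulr_ge0 h h; have := mulr_ge0 (ltW d0) (ltW d0).
  have : x n + d <= x n * x n by nra.
  split; lra.
have : 0 <= `|C| / d by rewrite divr_ge0// ltW.
move=> /archi_boundP; set n := Num.bound _; rewrite ltr_pdivrMr// => nC.
have [_] := xlow n.+2; have := xC n; have := ler_norm C.
rewrite -[n.+2%:R]natr1 -[n.+1%:R]natr1 !mulrDl !mul1r; lra.
Qed.

(** Indeed [(1 + m t) (1 - t)^m <= 1], by Bernoulli's inequality. *)
Lemma mulrn_onem_exp_le1 (R : realType) (t : R) m : 0 <= t <= 1 ->
  m%:R * t * (1 - t) ^+ m <= 1.
Proof.
move=> t01; suff : (1 + m%:R * t) * (1 - t) ^+ m <= 1.
  have : 0 <= (1 - t) ^+ m by rewrite exprn_ge0//; lra.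
  nra.
elim: m => [|m IH]; first by rewrite mul0r addr0 mulr1.
apply: le_trans IH; rewrite exprS mulrA.
apply: ler_wpM2r; first by rewrite exprn_ge0//; lra.
rewrite -[m.+1%:R]natr1; have m0 : 0 <= m%:R :> R by [].
have t0 : 0 <= t by lra.
have tt := mulr_ge0 t0 t0; have := mulr_ge0 m0 tt; nra.
Qed.

Section norm.
Context {R : realType} {A : normedStarAlgType R}.
Implicit Types a b : A.

Definition nrm a : R := complex.Re `|a|.

Lemma nrmE a : `|a| = (nrm a)%:C.
Proof. by rewrite RRe_real// normr_real. Qed.

Lemma nrm_ge0 a : 0 <= nrm a.
Proof. by have := normr_ge0 a; rewrite nrmE ler0c. Qed.

Lemma nrmM a b : nrm (amul a b) <= nrm a * nrm b.
Proof. by have := ler_normM a b; rewrite !nrmE -rmorphM lecR. Qed.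

Lemma nrmZ (r : R) a : nrm (r%:C *: a) = `|r| * nrm a.
Proof.
apply: complexI; rewrite -nrmE normrZ nrmE rmorphM; congr (_ * _).
by rewrite normc_def/= expr0n addr0 sqrtr_sqr.
Qed.

Lemma nrm_eq0 a : nrm a = 0 -> a = 0.
Proof. by move=> a0; apply/eqP; rewrite -normr_eq0 nrmE a0. Qed.

End norm.

(** * Characters of the unitization *)

Section characters_facts.
Context {R : realType} {A : normedStarAlgType R}.
Implicit Types (a b p q : A) (tau : spectrum A).

Lemma gelfandP tau : [/\ scalar (fun a : A => gelfand a tau),
  forall a b, gelfand (amul a b) tau = gelfand a tau * gelfand b tau,
  exists a, gelfand a tau != 0, hermitian_functional (fun a : A => gelfand a tau)
  & bounded_sa (fun a : A => gelfand a tau)].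
Proof. exact: set_valP tau. Qed.

Lemma gelfand_sa a tau : selfadjoint a -> gelfand a tau = (complex.Re (gelfand a tau))%:C.
Proof.
move=> sa; have [_ _ _ /(_ a)] := gelfandP tau.
rewrite sa conjE => h _; move: h; case: (gelfand a tau) => x y [] h.
by congr (_ +i* _); lra.
Qed.

Lemma gelfandD a b tau : gelfand (a + b) tau = gelfand a tau + gelfand b tau.
Proof. by have [/scalar_morph[_ -> _ _]] := gelfandP tau. Qed.

Lemma gelfandZ k a tau : gelfand (k *: a) tau = k * gelfand a tau.
Proof. by have [/scalar_morph[_ _ _ ->]] := gelfandP tau. Qed.

Lemma gelfandM a b tau : gelfand (amul a b) tau = gelfand a tau * gelfand b tau.
Proof. by have [_ -> _ _] := gelfandP tau. Qed.

Lemma gelfand_star a tau : gelfand (star a) tau = conjc (gelfand a tau).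
Proof. by have [_ _ _ ->] := gelfandP tau. Qed.

Lemma gelfand_spectrum_inj tau tau' :
  (forall a, selfadjoint a -> gelfand a tau = gelfand a tau') -> tau = tau'.
Proof.
move=> h; apply: val_inj; apply/funext => a.
change (gelfand a tau = gelfand a tau').
rewrite [a]re_im_part; have := h _ (re_part_sa a); have := h _ (im_part_sa a).
by move: (re_part a) (im_part a) => p q hq hp; rewrite !gelfandD !gelfandZ hp hq.
Qed.

(** Characters are contractive on the selfadjoint part, since the powers of an
    element of norm at most 1 have bounded values. *)
Lemma gelfand_le_nrm a tau : selfadjoint a -> `|complex.Re (gelfand a tau)| <= nrm a.
Proof.
suff contr b : selfadjoint b -> nrm b <= 1 -> `|complex.Re (gelfand b tau)| <= 1.
  move=> sa; have [a0|a0] := eqVneq (nrm a) 0.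
    rewrite a0 (nrm_eq0 a0).
    have [/scalar_morph[-> _ _ _] _ _ _ _] := gelfandP tau.
    by rewrite /= normr0.
  have na : 0 < nrm a by rewrite lt_neqAle eq_sym a0 nrm_ge0.
  have := contr ((nrm a)^-1%:C *: a) (saZ _ sa).
  rewrite nrmZ gtr0_norm ?invr_gt0// mulVf// lexx => /(_ isT).
  by rewrite gelfandZ Re_mulrC normrM gtr0_norm ?invr_gt0// ler_pdivrMl// mulr1.
move=> sb b1.
pose x n := `|complex.Re (gelfand b tau)| ^+ (2 ^ n).
have [_ _ _ _ [M HM]] := gelfandP tau.
apply: (@squaring_bounded _ x (`|M|)) => [n|n].
  by rewrite /x -exprD addnn -mul2n expnS.
rewrite /x -normrX.
have [c [sc c1 <-]] : exists c, [/\ selfadjoint c, nrm c <= 1 &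
    complex.Re (gelfand c tau) = complex.Re (gelfand b tau) ^+ (2 ^ n.+2)].
  elim: n.+2 => [|m [c [sc c1 cE]]]; first by exists b.
  exists (amul c c); split.
  - by rewrite /selfadjoint/= starM sc.
  - by apply: le_trans (nrmM _ _) _; have := nrm_ge0 c; nra.
  - rewrite gelfandM (gelfand_sa tau sc) -rmorphM/= cE.
    by rewrite -exprD addnn -mul2n expnS.
have := HM _ sc; rewrite (gelfand_sa tau sc) nrmE -rmorphM normc_def/=.
rewrite expr0n addr0 sqrtr_sqr lecR => /le_trans; apply.
apply: (@le_trans _ _ (`|M| * nrm c)).
  by apply: ler_wpM2r; [exact: nrm_ge0|exact: ler_norm].
by rewrite ler_piMr.
Qed.

Lemma re_part_unique p q : selfadjoint p -> selfadjoint q ->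
  re_part (p + 'i *: q) = p /\ im_part (p + 'i *: q) = q.
Proof.
move=> sp sq.
have s : star (p + 'i *: q) = p - 'i *: q.
  by rewrite starD starZ sp sq conj_i scaleNr.
split; rewrite /re_part /im_part s.
- by rewrite addrACA subrr addr0 scale_half_double.
- rewrite opprB addrC addrA subrK -scalerA scale_half_double scalerA.
  by rewrite mulNr -expr2 sqr_i opprK scale1r.
Qed.

End characters_facts.

Section unitization_characters.
Context {R : realType} {A : normedStarAlgType R}.
Variable amulC : commutative (@amul R A).
Local Notation B := (unitization amulC).
Local Notation X := (option (spectrum A)).

(** The Gelfand transform of [a + r 1] on the spectrum with a point at infinity,
    which stands for the zero functional on [A]. *)
Definition gelfand1 (b : B) (x : X) : R :=
  (if x is Some tau then complex.Re (gelfand (b.1 : A) tau) else 0) + b.2.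

Lemma unit_decomp (b : B) : b = unit_in amulC b.1 + b.2 *: 1.
Proof.
case: b => a r; congr pair => /=; first by rewrite scaler0 addr0.
by rewrite add0r; exact/esym/mulr1.
Qed.

Lemma gelfand1D (b c : B) x : gelfand1 (b + c) x = gelfand1 b x + gelfand1 c x.
Proof.
case: b c => [a r] [b s]; rewrite /gelfand1/=.
by case: x => [tau|]; rewrite ?gelfandD ?raddfD/=; ring.
Qed.

Lemma gelfand1Z (r : R) (b : B) x : gelfand1 (r *: b) x = r * gelfand1 b x.
Proof.
case: b => [a s]; rewrite /gelfand1/=.
case: x => [tau|]; last by rewrite !add0r.
by rewrite gelfandZ Re_mulrC mulrDr.
Qed.

Lemma gelfand1M (b c : B) x : gelfand1 (b * c) x = gelfand1 b x * gelfand1 c x.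
Proof.
case: b c => [a r] [b s]; rewrite /gelfand1/=.
case: x => [tau|]; last by rewrite !add0r.
rewrite !gelfandD gelfandM !gelfandZ.
rewrite (gelfand_sa tau (sa_partP a)) (gelfand_sa tau (sa_partP b)).
by rewrite -!rmorphM -!rmorphD/=; ring.
Qed.

Lemma gelfand1_1 x : gelfand1 1 x = 1.
Proof.
rewrite /gelfand1/=; case: x => [tau|]; last by rewrite add0r.
have [/scalar_morph[-> _ _ _] _ _ _ _] := gelfandP tau.
by rewrite /= add0r.
Qed.

Lemma gelfand1C (r : R) x : gelfand1 (r *: 1) x = r.
Proof. by rewrite gelfand1Z gelfand1_1 mulr1. Qed.

Lemma gelfand1N (b : B) x : gelfand1 (- b) x = - gelfand1 b x.
Proof. by rewrite -scaleN1r gelfand1Z mulN1r. Qed.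

Lemma gelfand1X (b : B) n x : gelfand1 (b ^+ n) x = gelfand1 b x ^+ n.
Proof.
by elim: n => [|n IH]; rewrite ?gelfand1_1// !exprS gelfand1M IH.
Qed.

Lemma gelfand1_algebra : function_algebra (range gelfand1).
Proof.
split.
- by move=> r; exists (r *: 1) => //; apply/funext => x; rewrite gelfand1C.
- move=> _ _ [b _ <-] [c _ <-]; exists (b + c) => //.
  by apply/funext => x; rewrite gelfand1D.
- move=> _ _ [b _ <-] [c _ <-]; exists (b * c) => //.
  by apply/funext => x; rewrite gelfand1M.
- move=> _ [b _ <-]; exists (nrm (b.1 : A) + `|b.2|) => x.
  rewrite /gelfand1; apply: le_trans (ler_normD _ _) _; apply: lerD => //.
  case: x => [tau|]; last by rewrite normr0 nrm_ge0.
  exact: gelfand_le_nrm (sa_partP _).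
Qed.

(** The extension of [sigma] by complex linearity is a character of [A], unless
    [sigma] vanishes on [A] and hence is evaluation at infinity. *)
Lemma unitization_character (sigma : B -> R) : scalar sigma ->
  (forall b c, sigma (b * c) = sigma b * sigma c) -> sigma 1 = 1 ->
  (forall a, `|sigma (unit_in amulC a)| <= nrm (a : A)) ->
  exists x, forall b, sigma b = gelfand1 b x.
Proof.
move=> sL sM s1 sB; have [s0 sD sN sZ] := scalar_morph sL.
pose f (a : sa_part A) := sigma (unit_in amulC a).
have fD a b : f (a + b) = f a + f b.
  by rewrite /f -sD; congr sigma; congr pair; rewrite addr0.
have fZ (r : R) a : f (r *: a) = r * f a.
  by rewrite /f -sZ; congr sigma; congr pair; rewrite [RHS]mulr0.
have fM a b : f (sa_mul amulC a b) = f a * f b.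
  rewrite /f -sM; congr sigma; congr pair; rewrite /= ?mulr0//.
  by rewrite !scale0r !addr0.
have sigmaE b : sigma b = f b.1 + b.2 by rewrite [in LHS](unit_decomp b) sD sZ s1 mulr1.
have [fn0|f0] := pselect (exists a, f a != 0); last first.
  exists None => b; rewrite sigmaE /gelfand1; congr (_ + _).
  by apply/eqP/negPn/negP => fn0; apply: f0; exists b.1.
have [p [q decomp]] : exists p q : A -> sa_part A,
    forall a, a = (p a : A) + 'i *: (q a : A).
  exists (fun a => sa_mk (re_part_sa a)), (fun a => sa_mk (im_part_sa a)).
  exact: re_im_part.
pose tau (a : A) : R[i] := f (p a) +i* f (q a).
have tauE (x y : sa_part A) : tau ((x : A) + 'i *: (y : A)) = f x +i* f y.
  rewrite /tau; set z := _ + _.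
  have [ex ey] := re_part_unique (sa_partP x) (sa_partP y).
  have [] := re_part_unique (sa_partP (p z)) (sa_partP (q z)).
  rewrite -decomp ex ey => px qy.
  by congr (f _ +i* f _); apply/val_inj.
have ii (x : A) : 'i *: ('i *: x) = - x by rewrite scalerA -expr2 sqr_i scaleN1r.
have scaleC (k l : R[i]) (v : A) : k *: (l *: v) = l *: (k *: v).
  by rewrite !scalerA mulrC.
have tauD a b : tau (a + b) = tau a + tau b.
  have -> : a + b = sa_val (p a + p b) + 'i *: sa_val (q a + q b).
    by rewrite [a in LHS]decomp [b in LHS]decomp addrACA -scalerDr.
  by rewrite tauE !fD.
have fN a : f (- a) = - f a by rewrite -scaleN1r fZ mulN1r.
have tauZ (k : R[i]) a : tau (k *: a) = k * tau a.
  rewrite [a in LHS]decomp; case: k => r s.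
  have -> : (r +i* s) *: ((p a : A) + 'i *: (q a : A)) =
      sa_val (r *: p a - s *: q a) + 'i *: sa_val (s *: p a + r *: q a).
    rewrite [r +i* s]complexE /= scalerDl -scalerA !scalerDr.
    rewrite (scaleC r%:C 'i) (scaleC s%:C 'i) ii.
    by rewrite [X in _ + X = _]addrC addrACA; congr (_ + _); exact: addrC.
  by rewrite tauE !fD fN !fZ [s * _ + _]addrC.
have tauM a b : tau (amul a b) = tau a * tau b.
  rewrite [a in LHS]decomp [b in LHS]decomp.
  have -> : amul ((p a : A) + 'i *: (q a : A)) ((p b : A) + 'i *: (q b : A)) =
      sa_val (sa_mul amulC (p a) (p b) - sa_mul amulC (q a) (q b))
      + 'i *: sa_val (sa_mul amulC (p a) (q b) + sa_mul amulC (q a) (p b)).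
    rewrite /= !amulDl !amulDr !amulZl !amulZr ii !scalerDr.
    set u := amul _ _; set v := 'i *: _; set w := 'i *: _; set t := amul _ _.
    by rewrite -addrA [v + _]addrCA !addrA addrAC -!addrA; congr (_ + _);
      rewrite addrCA [v + w]addrC.
  by rewrite tauE !fD fN !fM.
have tau_star a : tau (star a) = (tau a)^*%R.
  rewrite [a in LHS]decomp.
  have -> : star ((p a : A) + 'i *: (q a : A)) = sa_val (p a) + 'i *: sa_val (- q a).
    rewrite starD starZ (sa_partP (p a)) (sa_partP (q a)) conj_i.
    by rewrite scaleNr -scalerN.
  by rewrite tauE fN conjE.
have tau_sa (a : sa_part A) : tau a = (f a)%:C.
  have := tauE a 0; rewrite scaler0 addr0 => ->.
  by have := fZ 0 0; rewrite scale0r mul0r => ->.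
have tauP : tau \in characters A.
  apply/mem_set; split=> //.
  - by move=> k a b; rewrite tauD tauZ.
  - have [a fa] := fn0; exists (sa_val a); rewrite tau_sa; apply: contra fa => /eqP h.
    by apply/eqP; apply: complexI.
  - exists 1 => a sa; rewrite -[a]/(sa_mk sa : A) tau_sa mul1r nrmE normc_def/=.
    by rewrite expr0n addr0 sqrtr_sqr lecR; exact: sB.
exists (Some (SigSub tauP : spectrum A)) => b.
rewrite sigmaE /gelfand1; congr (_ + _).
by change (f b.1 = complex.Re (tau (sa_val b.1))); rewrite tau_sa.
Qed.

Definition re_elt (a : A) : B := unit_in amulC (sa_mk (re_part_sa a)).
Definition im_elt (a : A) : B := unit_in amulC (sa_mk (im_part_sa a)).

Lemma gelfand1_re_elt (a : A) tau :
  gelfand1 (re_elt a) (Some tau) = complex.Re (gelfand a tau).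
Proof.
rewrite /gelfand1/= addr0 [a in RHS]re_im_part.
move: (gelfand_sa tau (re_part_sa a)) (gelfand_sa tau (im_part_sa a)).
move: (re_part a) (im_part a) => p q; rewrite gelfandD gelfandZ => -> ->.
by simpc.
Qed.

Lemma gelfand1_im_elt (a : A) tau :
  gelfand1 (im_elt a) (Some tau) = complex.Im (gelfand a tau).
Proof.
rewrite /gelfand1/= addr0 [a in RHS]re_im_part.
move: (gelfand_sa tau (re_part_sa a)) (gelfand_sa tau (im_part_sa a)).
move: (re_part a) (im_part a) => p q; rewrite gelfandD gelfandZ => -> ->.
by simpc.
Qed.

End unitization_characters.

(** * States as positive functionals on the unitization *)

Section state.
Context {R : realType} {A : normedStarAlgType R}.
Variable amulC : commutative (@amul R A).
Local Notation B := (unitization amulC).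
Local Notation X := (option (spectrum A)).
Variable phi : A -> R[i].
Hypothesis phi_state : states A phi.
Implicit Types (b c d : B).

Let phiL : scalar phi. Proof. by case: phi_state => -[]. Qed.

Let phiD : {morph phi : a b / a + b}. Proof. by case: (scalar_morph phiL). Qed.
Let phiZ k a : phi (k *: a) = k * phi a. Proof. by case: (scalar_morph phiL). Qed.

Lemma state_sq_real (a : A) : phi (amul (star a) a) = (complex.Re (phi (amul (star a) a)))%:C.
Proof.
have : 0 <= phi (amul (star a) a) by case: phi_state => -[_ ->].
by case: (phi _) => x y; rewrite lecE/= => /andP[/eqP -> _].
Qed.

Lemma state_variation (a : A) :
  complex.Re (phi a) ^+ 2 + complex.Im (phi a) ^+ 2 <=
  complex.Re (phi (amul (star a) a)).
Proof.
have [_ _ [[_ /(_ a)]]] := phi_state.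
by rewrite mul1r -add_Re2_Im2 state_sq_real lecR.
Qed.

Definition phi1 (b : B) : R := complex.Re (phi b.1) + b.2.

Lemma phi1_scalar : scalar phi1.
Proof.
move=> r [a s] [b t]; rewrite /phi1/= phiD phiZ.
by rewrite ReD Re_mulrC -[r *: s]/(r * s); ring.
Qed.

Lemma phi1_unit_in a : phi1 (unit_in amulC a) = complex.Re (phi a).
Proof. by rewrite /phi1 addr0. Qed.

Lemma phi1_1 : phi1 1 = 1.
Proof. by rewrite /phi1/=; have [-> _ _ _] := scalar_morph phiL; rewrite add0r. Qed.

Lemma phi1_sq b : 0 <= phi1 (b * b).
Proof.
case: b => a r; rewrite /phi1/= !phiD !phiZ.
have := state_variation a; rewrite (sa_partP a).
move: (phi (a : A)) (phi (amul a a)) => [x y] [z w] /= h.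
have := sqr_ge0 (x + r); have := sqr_ge0 y.
by rewrite !expr2 in h *; nra.
Qed.

Let phi1D : {morph phi1 : a b / a + b}. Proof. by case: (scalar_morph phi1_scalar). Qed.
Let phi1N : {morph phi1 : a / - a}. Proof. by case: (scalar_morph phi1_scalar). Qed.
Let phi1Z r b : phi1 (r *: b) = r * phi1 b. Proof. by case: (scalar_morph phi1_scalar). Qed.

Lemma phi1_cauchy_schwarz b c : phi1 (b * c) ^+ 2 <= phi1 (b * b) * phi1 (c * c).
Proof.
have sq (r s : R) : 0 <= r * r * phi1 (b * b) + 2 * (r * s) * phi1 (b * c)
    + s * s * phi1 (c * c).
  have := phi1_sq (r *: b + s *: c).
  have -> : (r *: b + s *: c) * (r *: b + s *: c) = (r * r) *: (b * b)
      + (2 * (r * s)) *: (b * c) + (s * s) *: (c * c).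
    have sE (k : R) (x : B) : k *: x = in_alg B k * x by rewrite -mulr_algl.
    by rewrite !sE; ring.
  by rewrite !phi1D !phi1Z.
have p0 := phi1_sq b; have q0 := phi1_sq c; rewrite expr2.
move: (phi1 (b * b)) (phi1 (b * c)) (phi1 (c * c)) p0 q0 sq => p m q p0 q0 sq.
have [q00|q00] := eqVneq q 0.
  rewrite q00 mulr0.
  have [p00|p00] := eqVneq p 0.
    by have := sq m (- 1); rewrite p00 q00; have := sq m 1; rewrite p00 q00; nra.
  have := sq m (- (p / 2 + p / 2)); rewrite q00.
  have pp : 0 < p by rewrite lt_neqAle eq_sym p00.
  have h : m * m * p <= 0 -> m * m <= 0 by rewrite pmulr_lle0.
  move=> h2; apply: h; nra.
have qq : 0 < q by rewrite lt_neqAle eq_sym q00.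
have := sq q (- m).
have -> : q * q * p + 2 * (q * - m) * m + - m * - m * q = q * (p * q - m * m) by ring.
by rewrite pmulr_rge0// subr_ge0.
Qed.

(** Continuity at zero gives a bound near zero; homogeneity does the rest. *)
Lemma state_weakly_bounded (d : sa_part A) : exists C : R, forall a : sa_part A,
  nrm (a : A) <= 1 -> complex.Re (phi (amul (amul d a) d)) <= C.
Proof.
have [_ /(_ (d : A)) wc _] := phi_state.
rewrite (sa_partP d) in wc.
move/subspace_continuousP : wc => /(_ 0); rewrite /selfadjoint/= star0 => /(_ erefl).
move=> /cvgrPdist_lt /(_ 1 ltr01).
rewrite near_withinE => /nbhs_normP[e /= e0 He].
have eR : e = (complex.Re e)%:C by rewrite RRe_real// gtr0_real.
set r := complex.Re e in eR.
have r0 : 0 < r by rewrite -ltcR -eR.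
exists (2 / r) => a a1.
have r2 : 0 < r / 2 by lra.
have /He/(_ (saZ (r / 2) (sa_partP a))) : ball_ Num.norm (0 : A) e ((r / 2)%:C *: (a : A)).
  rewrite /ball_/= sub0r normrN nrmE nrmZ gtr0_norm// eR ltcR.
  have := nrm_ge0 (a : A); nra.
rewrite /from_subspace amulr0 amul0r.
have [-> _ _ _] := scalar_morph phiL.
rewrite sub0r normrN amulZr amulZl phiZ => /(le_lt_trans (normc_Re _)).
rewrite ltcR Re_mulrC => h.
have : r / 2 * complex.Re (phi (amul (amul d a) d)) < 1.
  exact: le_lt_trans (ler_norm _) h.
by rewrite ler_pdivlMr//; lra.
Qed.

Lemma unit_inX (a : sa_part A) m : nrm (a : A) <= 1 ->
  exists2 e : sa_part A, unit_in amulC a ^+ m.+1 = unit_in amulC e & nrm (e : A) <= 1.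
Proof.
move=> a1; elim: m => [|m [e eE e1]]; first by exists a.
exists (sa_mul amulC a e).
  by rewrite exprS eE; congr pair; rewrite /= ?mulr0// !scale0r !addr0.
by apply: le_trans (nrmM _ _) _; have := nrm_ge0 (a : A); have := nrm_ge0 (e : A); nra.
Qed.

Lemma unit_in_ideal (a : sa_part A) b :
  exists d : sa_part A, b * unit_in amulC a = unit_in amulC d.
Proof. by exists (b * unit_in amulC a).1; congr pair; rewrite /= mulr0. Qed.

(** The numbers [phi1 (c^2 a^(2^n))] dominate, up to the factor [phi1 (c^2)], the
    squares of their predecessors by the Cauchy-Schwarz inequality. They are
    bounded by weak continuity, since [c a] belongs to [A]. *)
Lemma phi1_contractive (a : sa_part A) c : nrm (a : A) <= 1 ->
  phi1 (c * c * unit_in amulC a) <= phi1 (c * c).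
Proof.
move=> a1; set s := phi1 (c * c); set u := unit_in amulC a.
pose y n := phi1 (c * c * u ^+ (2 ^ n)).
have yS n : y n * y n <= s * y n.+1.
  have := phi1_cauchy_schwarz c (c * u ^+ (2 ^ n)).
  rewrite expr2 mulrA.
  have -> : c * u ^+ (2 ^ n) * (c * u ^+ (2 ^ n)) = c * c * u ^+ (2 ^ n.+1).
    by rewrite expnS mul2n -addnn exprD; ring.
  by [].
have s0 : 0 <= s by exact: phi1_sq.
have [s00|s00] := eqVneq s 0.
  have := yS 0%N; rewrite s00 mul0r /y expn0 expr1.
  by move: (phi1 _) => z; nra.
have sp : 0 < s by rewrite lt_neqAle eq_sym s00.
have [d dE] := unit_in_ideal a c.
have [C HC] := state_weakly_bounded d.
have := @squaring_bounded _ (fun n => y n / s) (C / s).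
rewrite /y expn0 expr1 ler_pdivrMr// mul1r; apply=> n.
- have := yS n; rewrite /y => h.
  have divs (z : R) : z / s * (z / s) = z * z / s / s by field.
  by rewrite divs ler_pM2r ?invr_gt0// ler_pdivrMr// [_ * s]mulrC.
- rewrite ler_pM2r ?invr_gt0//.
  have [m mE] : exists m, (2 ^ n.+2 = m.+3)%N.
    have : (2 ^ 2 <= 2 ^ n.+2)%N by rewrite leq_exp2l.
    by case: (2 ^ n.+2)%N => [|[|[|m]]] // _; exists m.
  have [e eE e1] := unit_inX m a1.
  have -> : c * c * u ^+ (2 ^ n.+2) = unit_in amulC d * unit_in amulC d * unit_in amulC e.
    by rewrite mE -eE -dE -/u !exprS; ring.
  have -> : unit_in amulC d * unit_in amulC d * unit_in amulC e =
      unit_in amulC (sa_mul amulC (sa_mul amulC d e) d).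
    rewrite mulrAC; congr pair; rewrite /= ?mulr0// !scale0r !addr0.
    by congr sa_mul; rewrite !scale0r !addr0.
  by rewrite phi1_unit_in; exact: HC.
Qed.

Lemma phi1_bounded b : exists r, forall c, phi1 (c * c * b) <= r * phi1 (c * c).
Proof.
pose N := nrm (b.1 : A) + 1.
have N0 : 0 < N by rewrite /N; have := nrm_ge0 (b.1 : A); lra.
exists (N + b.2) => c.
rewrite {1}(unit_decomp b) mulrDr phi1D -scalerAr phi1Z mulr1 mulrDl lerD2r.
have -> : unit_in amulC b.1 = N *: unit_in amulC (N^-1 *: b.1).
  congr pair => /=; last by rewrite [RHS]mulr0.
  by rewrite scalerA mulfV ?scale1r// gt_eqF.
rewrite -scalerAr phi1Z; apply: ler_wpM2l; first exact: ltW.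
apply: phi1_contractive; rewrite /= nrmZ gtr0_norm ?invr_gt0//.
by rewrite ler_pdivrMl// mulr1 /N; lra.
Qed.

Lemma phi1_module_contractive (a : sa_part A) : nrm (a : A) <= 1 ->
  support_module phi1 (1 - unit_in amulC a).
Proof.
move=> a1 c; rewrite mulrBr mulr1 phi1D phi1N subr_ge0.
exact: phi1_contractive.
Qed.

(** The characters that the Positivstellensatz asks for are contractive on [A], so
    they are evaluations at points of the spectrum or at infinity. *)
Lemma phi1_pos b : (forall x, 0 <= gelfand1 b x) -> 0 <= phi1 b.
Proof.
move=> b0; apply: (positive_on_characters phi1_scalar phi1_sq phi1_bounded).
move=> sigma [sL sM s1 sQ].
have [s0 sD sN sZ] := scalar_morph sL.
have bnd (a : sa_part A) : nrm (a : A) <= 1 -> sigma (unit_in amulC a) <= 1.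
  by move=> /phi1_module_contractive/sQ; rewrite sD sN s1 subr_ge0.
have inZ (r : R) a : sigma (unit_in amulC (r *: a)) = r * sigma (unit_in amulC a).
  by rewrite -sZ; congr sigma; congr pair; rewrite [RHS]mulr0.
have bnd1 (a : sa_part A) : sigma (unit_in amulC a) <= nrm (a : A).
  have [a0|a0] := eqVneq (nrm (a : A)) 0.
    have -> : a = 0 by apply/val_inj; exact: nrm_eq0.
    by have := inZ 0 0; rewrite scale0r mul0r => ->; exact: nrm_ge0.
  have na : 0 < nrm (a : A) by rewrite lt_neqAle eq_sym a0 nrm_ge0.
  have := bnd ((nrm (a : A))^-1 *: a).
  by rewrite inZ /= nrmZ gtr0_norm ?invr_gt0// mulVf// lexx ler_pdivrMl// mulr1; apply.
have [x xE] : exists x, forall b, sigma b = gelfand1 b x.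
  apply: unitization_character => // a; rewrite ler_norml bnd1 andbT lerNl.
  have -> : - sigma (unit_in amulC a) = sigma (unit_in amulC (- a)).
    by rewrite -[- a]scaleN1r inZ mulN1r.
  by apply: le_trans (bnd1 _) _; rewrite /= /nrm normrN.
by rewrite xE.
Qed.

(** For selfadjoint [a] of norm at most 1 and [h = a^2], the element
    [a - a (1 - h)^n] is a product of two selfadjoint elements, at which [phi] is
    real, while [phi (a (1 - h)^n)] tends to [0] because
    [h (1 - h)^(2 n) <= 1 / (2 n)] on the spectrum. *)
Lemma state_sa_real (a : A) : selfadjoint a -> phi a = (complex.Re (phi a))%:C.
Proof.
suff H (b : sa_part A) : nrm (b : A) <= 1 -> complex.Im (phi b) = 0.
  move=> sa; pose N := nrm a + 1.
  have N0 : 0 < N by rewrite /N; have := nrm_ge0 a; lra.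
  have := H (N^-1 *: sa_mk sa); rewrite /= nrmZ gtr0_norm ?invr_gt0// ler_pdivrMl// mulr1.
  rewrite phiZ Im_mulrC => /(_ ltac:(rewrite /N; lra)) /eqP.
  rewrite mulf_eq0 invr_eq0 gt_eqF//= => /eqP.
  by case: (phi a) => x y /= ->.
move=> b1.
have sq_real (x : sa_part A) : complex.Im (phi (amul x x)) = 0.
  by have := state_sq_real x; rewrite (sa_partP x) => ->.
have ImN (x : A) : complex.Im (phi (- x)) = - complex.Im (phi x).
  by rewrite -scaleN1r phiZ mulN1r; case: (phi x).
have prod_real (x y : sa_part A) : complex.Im (phi (amul x y)) = 0.
  have := sq_real (x + y); have /= := sq_real x; have /= := sq_real y.
  rewrite /= amulDl !amulDr !phiD !ImD [amul y x]amulC; lra.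
set u := unit_in amulC b.
have small n : complex.Im (phi b) ^+ 2 * (n.*2)%:R <= 1.
  pose w := u * (1 - u * u) ^+ n.
  have [d dE] : exists d : sa_part A, w = unit_in amulC d.
    by exists w.1; congr pair; rewrite /= mul0r.
  have [e eE] : exists e : sa_part A, 1 - (1 - u * u) ^+ n = unit_in amulC e.
    exists (1 - (1 - u * u) ^+ n).1.
    rewrite [LHS](unit_decomp) [X in X *: _](_ : _ = 0) ?scale0r ?addr0//.
    have e2 (z : B) : z.2 = gelfand1 z None by rewrite /gelfand1 add0r.
    rewrite e2 gelfand1D gelfand1_1 gelfand1N gelfand1X.
    rewrite gelfand1D gelfand1N gelfand1_1 gelfand1M.
    by rewrite /gelfand1/= addr0 mul0r subr0 expr1n subrr.
  have bE : (b : A) = (d : A) + amul b e.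
    have : u = w + u * unit_in amulC e by rewrite -eE /w; ring.
    rewrite dE => /(congr1 fst); rewrite /= !scale0r !addr0.
    by move=> /(congr1 (@sa_val R A)).
  have -> : complex.Im (phi b) = complex.Im (phi d).
    by rewrite [in LHS]bE phiD ImD prod_real addr0.
  have v := state_variation d; rewrite (sa_partP d) in v.
  have : phi1 (n.*2%:R *: (w * w)) <= 1.
    rewrite -subr_ge0 -[X in X - _]phi1_1 -phi1N -phi1D; apply: phi1_pos => x.
    rewrite gelfand1D gelfand1_1 gelfand1N gelfand1Z subr_ge0 /w.
    rewrite !(gelfand1M, gelfand1X, gelfand1D, gelfand1N, gelfand1_1).
    set t := gelfand1 u x.
    have t1 : 0 <= t * t <= 1.
      have : `|t| <= 1.
        rewrite /t /gelfand1/= addr0; case: x @t => [tau|] /=; last by rewrite normr0.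
        by apply: le_trans b1; exact: gelfand_le_nrm (sa_partP _).
      by rewrite ler_norml; nra.
    have := mulrn_onem_exp_le1 n.*2 t1; rewrite -addnn exprD.
    move: ((1 - t * t) ^+ n) => z; congr (_ <= _); ring.
  rewrite phi1Z dE.
  have -> : phi1 (unit_in amulC d * unit_in amulC d) = complex.Re (phi (amul d d)).
    rewrite -[RHS](phi1_unit_in (sa_mul amulC d d)).
    by congr phi1; congr pair; rewrite /= ?mulr0// !scale0r !addr0.
  move=> h; apply: le_trans h; rewrite mulrC; apply: ler_wpM2l => //.
  by apply: le_trans v; rewrite lerDr sqr_ge0.
apply/eqP; rewrite -sqrf_eq0; apply/eqP.
set z := _ ^+ 2 in small *.
have z0 : 0 <= z by rewrite sqr_ge0.
apply/eqP; rewrite eq_le z0 andbT leNgt; apply/negP => zp.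
have /archi_boundP : 0 <= z^-1 by rewrite invr_ge0.
set n := Num.bound _ => zn.
have := small n; rewrite -addnn natrD.
have : 1 < z * n%:R by rewrite -ltr_pdivrMl// mulr1.
lra.
Qed.

End state.

(** * The topology of the spectrum *)

Section spectrum_topology.
Context {R : realType} {A : normedStarAlgType R}.
Implicit Types tau : spectrum A.

Lemma Re_continuous (T : topologicalType) (f : T -> R[i]) :
  continuous (f : T -> R[i]^o) -> continuous (fun x => complex.Re (f x)).
Proof.
move=> cf x; apply/cvgrPdist_lt => e e0.
have eC : 0 < e%:C by rewrite ltcR.
have /cvgrPdist_lt /(_ _ eC) := @cf x.
apply: filterS => y; rewrite -ltcR; apply: le_lt_trans.
have <- : complex.Re (f x - f y) = complex.Re (f x) - complex.Re (f y).
  by case: (f x) (f y) => a b [].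
exact: normc_Re.
Qed.

Lemma gelfand_continuous (a : A) : selfadjoint a ->
  continuous (fun tau => complex.Re (gelfand a tau)).
Proof.
move=> sa; apply: Re_continuous => tau.
pose s : selfadjoint := SigSub (mem_set sa).
have /pointwise_cvgP : {ptws, @eval_sa R A @ (tau : spectrum A) --> @eval_sa R A tau}.
  exact: initial_continuous.
by move=> /(_ (fmap_filter _ (nbhs_filter tau)) s).
Qed.

Lemma spectrum_cvg (F : set_system (spectrum A)) tau : Filter F ->
  (forall a : A, selfadjoint a ->
    (fun x => complex.Re (gelfand a x)) @ F --> complex.Re (gelfand a tau)) ->
  F --> tau.
Proof.
move=> FF H U /= [_ [[C oC <-] Cx] CU].
rewrite nbhs_filterE; apply: filterS CU _.
have : {ptws, @eval_sa R A @ F --> @eval_sa R A tau}.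
  apply/pointwise_cvgP => s; apply/cvgrPdist_lt => e e0.
  have sa : selfadjoint (set_val s) := set_valP s.
  have eR : e = (complex.Re e)%:C by rewrite RRe_real// gtr0_real.
  rewrite eR ltcR in e0.
  have /cvgrPdist_lt /(_ _ e0) := H _ sa.
  apply: filterS => x.
  change (`|complex.Re (gelfand (set_val s) tau) -
            complex.Re (gelfand (set_val s) x)| < complex.Re e ->
   `|gelfand (set_val s) tau - gelfand (set_val s) x| < e).
  rewrite (gelfand_sa tau sa) (gelfand_sa x sa) eR -rmorphB normc_def/=.
  by rewrite expr0n addr0 sqrtr_sqr ltcR.
by apply; apply: open_nbhs_nbhs.
Qed.

Lemma spectrum_hausdorff : hausdorff_space (spectrum A).
Proof.
move=> p q pq; apply: gelfand_spectrum_inj => a sa.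
rewrite (gelfand_sa p sa) (gelfand_sa q sa); congr (_ +i* _).
apply: (@Rhausdorff R) => U V pU qV.
have := pq _ _ (@gelfand_continuous _ sa p _ pU) (@gelfand_continuous _ sa q _ qV).
by move=> [x [Ux Vx]]; exists (complex.Re (gelfand a x)).
Qed.

Variable amulC : commutative (@amul R A).
Local Notation B := (unitization amulC).

Lemma gelfand1_continuous (b : B) : continuous (fun tau => gelfand1 b (Some tau)).
Proof.
move=> tau; pose f (t : spectrum A) := complex.Re (gelfand (b.1 : A) t).
change ((fun t => f t + b.2) @ tau --> f tau + b.2).
have FF := @nbhs_filter (spectrum A) tau.
apply: cvgD; last exact: cvg_cst.
exact: (@gelfand_continuous _ (sa_partP b.1) tau).
Qed.

(** Along an ultrafilter on the spectrum the values of every element converge, and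
    the limits form a character or vanish on [A]; the latter is excluded by a
    condition that fails at infinity. *)
Lemma spectrum_compact (b : B) (d : R) : gelfand1 b None < d ->
  compact [set tau | d <= gelfand1 b (Some tau)].
Proof.
move=> bd; rewrite compact_ultra => F FU FK.
have lim_ex (c : B) : exists r : R, (fun tau => gelfand1 c (Some tau)) @ F --> r.
  have [_ _ _ /(_ _ (imageT (@gelfand1 _ _ amulC) c))[M cM]] := gelfand1_algebra amulC.
  pose f tau := gelfand1 c (Some tau).
  have FfM : (f @ F) [set` `[- M, M]].
    apply: (@filterS _ F _ setT) filterT => tau _; have := cM (Some tau).
    by rewrite ler_norml /= in_itv.
  have [r [_ clr]] := @segment_compact R (- M) M (f @ F) _ FfM.
  exists r => U rU; have [//|FNU] := in_ultra_setVsetC (f @^-1` U) FU.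
  have [y [NUy Uy]] := clr (~` U) U FNU rU.
  by [].
have /choice[sigma sigmaP] := lim_ex.
have sigmaE c r : (fun tau => gelfand1 c (Some tau)) @ F --> r -> sigma c = r.
  by move=> h; apply: (cvg_unique (@Rhausdorff R) (sigmaP c) h).
have sD c e : sigma (c + e) = sigma c + sigma e.
  apply: sigmaE; under eq_fun do rewrite gelfand1D.
  by apply: cvgD; exact: sigmaP.
have sZ (r : R) c : sigma (r *: c) = r * sigma c.
  apply: sigmaE; under eq_fun do rewrite gelfand1Z.
  by apply: cvgM; [exact: cvg_cst|exact: sigmaP].
have [x xE] : exists x, forall c, sigma c = gelfand1 c x.
  apply: unitization_character.
  - by move=> r c e; rewrite sD sZ.
  - move=> c e; apply: sigmaE; under eq_fun do rewrite gelfand1M.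
    by apply: cvgM; exact: sigmaP.
  - by apply: sigmaE; under eq_fun do rewrite gelfand1_1; exact: cvg_cst.
  - move=> a; have := sigmaP (unit_in amulC a).
    move=> /cvg_norm/cvgr_to_le; apply.
    apply: (@filterS _ F _ setT) filterT => tau _; rewrite /gelfand1/= addr0.
    exact: gelfand_le_nrm (sa_partP _).
have dx : d <= gelfand1 b x.
  by rewrite -xE; apply: (cvgr_to_ge (sigmaP b)); exact: FK.
case: x xE dx => [tau|] xE dx; last by move: bd; rewrite ltNge dx.
exists tau; split=> //; apply: spectrum_cvg => a sa.
have := sigmaP (unit_in amulC (sa_mk sa)); rewrite xE /gelfand1/= addr0.
by under eq_fun do rewrite addr0.
Qed.

End spectrum_topology.

(** * Integrals of bounded Borel functions *)

Section expectation.
Context {R : realType} {T : topologicalType}.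
Variable mu : M1 R T.
Implicit Types f g : T -> R.

Definition bounded_borel f :=
  measurable_fun [set: borel (M1_point mu)] (f : borel (M1_point mu) -> R) /\
  exists M : R, forall y, `|f y| <= M.

Definition expect f : R := Rintegral mu setT f.

Definition mass (B : set T) : R := fine (M1_prob mu B).

Lemma massE (B : set T) : <<s @open T >> B -> M1_prob mu B = (mass B)%:E.
Proof. by move=> mB; rewrite fineK//; exact: fin_num_measure. Qed.

Lemma bounded_borel_integrable f : bounded_borel f ->
  mu.-integrable setT (EFin \o (f : borel (M1_point mu) -> R)).
Proof.
move=> [mf [M fM]]; apply: measurable_bounded_integrable => //.
  by apply: le_lt_trans (probability_le1 _ _) _; rewrite ?ltry.
by exists M; split; [exact: num_real|move=> r Mr y _ /=; exact: le_trans (ltW Mr)].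
Qed.

Lemma bounded_borelD f g : bounded_borel f -> bounded_borel g ->
  bounded_borel (fun y => f y + g y).
Proof.
move=> [mf [M fM]] [mg [N gN]]; split; first exact: measurable_funD.
exists (M + N) => y; apply: le_trans (ler_normD _ _) _; exact: lerD.
Qed.

Lemma bounded_borelM f g : bounded_borel f -> bounded_borel g ->
  bounded_borel (fun y => f y * g y).
Proof.
move=> [mf [M fM]] [mg [N gN]]; split; first exact: measurable_funM.
by exists (M * N) => y; rewrite normrM; apply: ler_pM.
Qed.

Lemma bounded_borel_cst (r : R) : bounded_borel (fun=> r).
Proof. by split; [exact: measurable_cst|exists `|r|]. Qed.

Lemma bounded_borelZ (r : R) f : bounded_borel f -> bounded_borel (fun y => r * f y).
Proof. by move=> bf; apply: bounded_borelM => //; exact: bounded_borel_cst. Qed.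

Lemma bounded_borel_indic (B : set T) : <<s @open T >> B -> bounded_borel (\1_B : T -> R).
Proof.
move=> mB; split; first exact: measurable_indic.
by exists 1 => y; rewrite indicE; case: (_ \in _); rewrite ?normr1 ?normr0.
Qed.

Lemma bounded_borel_continuous f (M : R) : continuous f ->
  (forall y, `|f y| <= M) -> bounded_borel f.
Proof.
move=> /continuousP cf fM; split; last by exists M.
apply: (measurability _ (RGenOpens.measurableE R)).
move=> _ [_ [a [b ->] <-]]; rewrite setTI.
by apply: sub_sigma_algebra; apply: cf; exact: interval_open.
Qed.

Lemma bounded_borel_sum n (f : nat -> T -> R) : (forall k, bounded_borel (f k)) ->
  bounded_borel (fun y => \sum_(k < n) f k y).
Proof.
move=> bf; elim: n => [|n IH].
  under eq_fun do rewrite big_ord0.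
  exact: bounded_borel_cst.
by under eq_fun do rewrite big_ord_recr/=; exact: bounded_borelD.
Qed.

Lemma expectD f g : bounded_borel f -> bounded_borel g ->
  expect (fun y => f y + g y) = expect f + expect g.
Proof. by move=> bf bg; apply: RintegralD => //; exact: bounded_borel_integrable. Qed.

Lemma expectZ (r : R) f : bounded_borel f -> expect (fun y => r * f y) = r * expect f.
Proof. by move=> bf; apply: RintegralZl => //; exact: bounded_borel_integrable. Qed.

Lemma expect_cst (r : R) : expect (fun=> r) = r.
Proof.
rewrite /expect Rintegral_cst//= (_ : _ setT = 1%E) ?mulr1//.
exact: probability_setT.
Qed.

Lemma le_expect f g : bounded_borel f -> bounded_borel g ->
  (forall y, f y <= g y) -> expect f <= expect g.
Proof.
by move=> bf bg fg; apply: le_Rintegral => //; exact: bounded_borel_integrable.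
Qed.

Lemma expect_indic (B : set T) : <<s @open T >> B -> expect (\1_B : T -> R) = mass B.
Proof. by move=> mB; rewrite /expect /Rintegral integral_indic// setIT. Qed.

Lemma expect_sum n (f : nat -> T -> R) : (forall k, bounded_borel (f k)) ->
  expect (fun y => \sum_(k < n) f k y) = \sum_(k < n) expect (f k).
Proof.
move=> bf; elim: n => [|n IH].
  by rewrite big_ord0; under eq_fun do rewrite big_ord0; exact: expect_cst.
under eq_fun do rewrite big_ord_recr/=.
by rewrite expectD ?IH ?big_ord_recr//; exact: bounded_borel_sum.
Qed.

Lemma massT : mass setT = 1.
Proof. by rewrite /mass probability_setT. Qed.

Lemma le_mass B C : <<s @open T >> B -> <<s @open T >> C -> B `<=` C ->
  mass B <= mass C.
Proof.
move=> mB mC BC; rewrite -lee_fin -!massE//.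
by apply: le_measure; rewrite ?inE.
Qed.

Hypothesis hT : hausdorff_space T.

Lemma borel_compact (K : set T) : compact K -> <<s @open T >> K.
Proof.
move=> cK; have := @measurableC _ (borel (M1_point mu)) (~` K).
rewrite setCK; apply; apply: sub_sigma_algebra.
by apply: closed_openC; exact: compact_closed.
Qed.

Lemma mass_inner (B : set T) (e : R) : <<s @open T >> B -> 0 < e ->
  exists K, [/\ compact K, K `<=` B & mass B <= mass K + e].
Proof.
move=> mB e0; have := M1_inner_regular mu mB; rewrite massE// => Bsup.
have : ereal_sup [set M1_prob mu K | K in [set K | compact K /\ K `<=` B]] \is a fin_num.
  by rewrite -Bsup.
move=> /(ub_ereal_sup_adherent e0)[_ [K [cK KB] <-]].
rewrite -Bsup massE; last exact: borel_compact.
by rewrite -EFinB lte_fin => h; exists K; split=> //; lra.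
Qed.

End expectation.

(** * Functionals on the unitization as integrals *)

Section counting.
Context {R : realType}.
Implicit Types (w : R) (n : nat).

(** The sum of steps below is the minimum of [n] and of the integer part of [w]. *)
Lemma sum_steps_full n w : n%:R <= w ->
  \sum_(k < n) (k.+1%:R <= w)%R%:R = n%:R :> R.
Proof.
elim: n => [|n IH] nw; first by rewrite big_ord0.
rewrite big_ord_recr/= nw IH ?natr1//.
by apply: le_trans nw; rewrite ler_nat.
Qed.

Lemma sum_steps_ge n w : w <= n%:R -> w - 1 <= \sum_(k < n) (k.+1%:R <= w)%R%:R.
Proof.
elim: n => [|n IH] wn; first by rewrite big_ord0; lra.
rewrite big_ord_recr/=; have [wn'|nw] := leP w n%:R.
  by apply: le_trans (IH wn') _; rewrite lerDl.
rewrite sum_steps_full; last exact: ltW.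
have nS : n.+1%:R = n%:R + 1 :> R by rewrite natr1.
rewrite nS in wn; apply: (@le_trans _ _ n%:R); first lra.
by rewrite lerDl.
Qed.

Lemma sum_steps_le n w : 0 <= w -> \sum_(k < n) (k.+1%:R <= w)%R%:R <= w.
Proof.
move=> w0; elim: n => [|n IH]; first by rewrite big_ord0.
have [nw|nw] := leP n.+1%:R w; first by rewrite sum_steps_full.
by rewrite big_ord_recr/= (lt_geF nw) addr0.
Qed.

End counting.

Section spectrum_functionals.
Context {R : realType} {A : normedStarAlgType R}.
Variable amulC : commutative (@amul R A).
Local Notation B := (unitization amulC).
Local Notation X := (option (spectrum A)).
Implicit Types (b c : B) (K L : set (spectrum A)) (mu nu : M1 R (spectrum A)).

(** Nonnegativity is required at infinity as well, since the functionals under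
    consideration are only known to be monotone with respect to the transforms on
    the spectrum with that point. *)
Definition majorants K : set B :=
  [set b | (forall x, 0 <= gelfand1 b x) /\ forall tau, K tau -> 1 <= gelfand1 b (Some tau)].

Lemma spectrum_urysohn K L (e : R) : compact K -> compact L -> K `&` L = set0 ->
  0 < e -> exists b, [/\ forall x, 0 <= gelfand1 b x <= 1,
    forall tau, K tau -> 1 - e <= gelfand1 b (Some tau),
    forall tau, L tau -> gelfand1 b (Some tau) <= e & gelfand1 b None <= e].
Proof.
move=> cK cL KL e0.
have sep_sa tau tau' : tau <> tau' ->
    exists a : sa_part A, gelfand1 (unit_in amulC a) (Some tau) !=
      gelfand1 (unit_in amulC a) (Some tau').
  move=> tt'; apply: contrapT => H; apply: tt'; apply: gelfand_spectrum_inj => a sa.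
  rewrite (gelfand_sa tau sa) (gelfand_sa tau' sa); congr (_ +i* _).
  have [//|ne] := eqVneq (complex.Re (gelfand a tau)) (complex.Re (gelfand a tau')).
  by exfalso; apply: H; exists (sa_mk sa); rewrite /gelfand1/= !addr0.
have sep_inf tau : exists a : sa_part A, gelfand1 (unit_in amulC a) (Some tau) !=
      gelfand1 (unit_in amulC a) None.
  apply: contrapT => H; have [_ _ [a /eqP]] := gelfandP tau; case.
  have z (p : A) : selfadjoint p -> gelfand p tau = 0.
    move=> sp; rewrite (gelfand_sa tau sp).
    have [->//|ne] := eqVneq (complex.Re (gelfand p tau)) 0.
    by exfalso; apply: H; exists (sa_mk sp); rewrite /gelfand1/= !addr0.
  rewrite [a]re_im_part; move: (z _ (re_part_sa a)) (z _ (im_part_sa a)).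
  move: (re_part a) (im_part a) => p q zp zq.
  by rewrite gelfandD gelfandZ zp zq mulr0 addr0.
have := @algebra_urysohn R (spectrum A) X Some _ (gelfand1_algebra amulC) _
  K L None e cK cL KL.
case=> [_ [b _ <-]|x y /sep_sa[a ha]|x|//|_ [b _ <-] [b1 b2 b3 b4]].
- exact: gelfand1_continuous.
- by exists (gelfand1 (unit_in amulC a)).
- by have [a ha] := sep_inf x; exists (gelfand1 (unit_in amulC a)).
- by exists b.
Qed.

Definition integ mu b : R := expect mu (fun tau => gelfand1 b (Some tau)).

Lemma gelfand1_bounded_borel mu b :
  bounded_borel mu (fun tau => gelfand1 b (Some tau)).
Proof.
have [_ _ _ /(_ _ (imageT (@gelfand1 _ _ amulC) b))[M bM]] := gelfand1_algebra amulC.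
by apply: (@bounded_borel_continuous _ _ _ _ M) => //; exact: gelfand1_continuous.
Qed.

Lemma integ_scalar mu : scalar (integ mu).
Proof.
move=> r b c; rewrite /integ; under eq_fun do rewrite gelfand1D gelfand1Z.
have bb := gelfand1_bounded_borel mu.
by rewrite expectD ?expectZ//; exact: bounded_borelZ.
Qed.

Lemma integ1 mu : integ mu 1 = 1.
Proof. by rewrite /integ; under eq_fun do rewrite gelfand1_1; exact: expect_cst. Qed.

Lemma integ_le mu b c :
  (forall tau, gelfand1 b (Some tau) <= gelfand1 c (Some tau)) -> integ mu b <= integ mu c.
Proof. by move=> bc; apply: le_expect => //; exact: gelfand1_bounded_borel. Qed.

Lemma integ_ge0 mu b : (forall x, 0 <= gelfand1 b x) -> 0 <= integ mu b.
Proof.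
move=> b0; have [<- _ _ _] := scalar_morph (integ_scalar mu).
by apply: integ_le => tau; rewrite -(scale0r (1 : B)) gelfand1C.
Qed.

Lemma integ_ge_mass mu K b (r : R) : compact K -> 0 <= r ->
  (forall tau, 0 <= gelfand1 b (Some tau)) ->
  (forall tau, K tau -> r <= gelfand1 b (Some tau)) -> r * mass mu K <= integ mu b.
Proof.
move=> cK r0 b0 bK; have mK := borel_compact mu spectrum_hausdorff cK.
rewrite -(expect_indic mu mK) -expectZ; last exact: bounded_borel_indic.
apply: le_expect => [||tau]; last 1 first.
- rewrite indicE; case: (boolP (tau \in K)) => tK; last by rewrite mulr0.
  by rewrite mulr1; apply: bK; exact: set_mem.
- by apply: bounded_borelZ; exact: bounded_borel_indic.
- exact: gelfand1_bounded_borel.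
Qed.

(** A compact part of the complement of [K] carries nearly the whole mass of that
    complement, and an element that is close to 1 on [K] and small on this part is a
    majorant up to a small constant. Convex combinations of measures call for one
    majorant that serves two measures. *)
Lemma small_majorant mu nu K (e : R) : compact K -> 0 < e ->
  exists c, [/\ majorants K c, integ mu c <= mass mu K + e & integ nu c <= mass nu K + e].
Proof.
move=> cK e0; pose d := e / 4; have d0 : 0 < d by rewrite /d; lra.
have hS := @spectrum_hausdorff R A.
have mK := borel_compact mu hS cK.
have mNK : <<s @open (spectrum A) >> (~` K).
  by apply: sub_sigma_algebra; apply: closed_openC; exact: compact_closed.
have [L1 [cL1 L1K muL1]] := mass_inner mu hS mNK d0.
have [L2 [cL2 L2K nuL2]] := mass_inner nu hS mNK d0.
have cL : compact (L1 `|` L2) by exact: compactU.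
have KL : K `&` (L1 `|` L2) = set0.
  by rewrite -subset0 => tau [Kt [/L1K|/L2K]].
have [b [b01 bK bL bo]] := spectrum_urysohn cK cL KL d0.
exists (b + d *: 1).
suff H (m : M1 R (spectrum A)) (L : set (spectrum A)) : compact L -> L `<=` ~` K ->
    L `<=` L1 `|` L2 ->
    mass m (~` K) <= mass m L + d -> integ m (b + d *: 1) <= mass m K + e.
  split; [split=> [x|tau Kt]|exact: (H mu L1)|exact: (H nu L2)].
  - by rewrite gelfand1D gelfand1C; have := b01 x; lra.
  - by rewrite gelfand1D gelfand1C; have := bK _ Kt; lra.
move=> cl LK LL mL.
have mL' := borel_compact m hS cl.
have [_ iD _ iZ] := scalar_morph (integ_scalar m).
rewrite iD iZ integ1 mulr1.
suff : integ m b <= mass m K + d + (mass m (~` K) - mass m L) by rewrite /d in mL *; lra.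
have bi C : <<s @open (spectrum A) >> C -> bounded_borel m (\1_C : spectrum A -> R).
  exact: bounded_borel_indic.
have -> : mass m K + d + (mass m (~` K) - mass m L) =
    expect m (fun tau => \1_K tau + d + (\1_(~` K) tau + -1 * \1_L tau)).
  have bK1 := bi _ mK; have bK2 := bi _ mNK; have bL1 := bi _ mL'.
  have bL2 := bounded_borelZ (-1) bL1.
  have bd := bounded_borel_cst m d.
  rewrite (expectD (bounded_borelD bK1 bd) (bounded_borelD bK2 bL2)).
  rewrite (expectD bK1 bd) (expectD bK2 bL2) (expectZ _ bL1) expect_cst !expect_indic//.
  by rewrite mulN1r.
apply: le_expect => [||tau].
- exact: gelfand1_bounded_borel.
- apply: bounded_borelD; apply: bounded_borelD;
    [exact: bi|exact: bounded_borel_cst|exact: bi|].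
  by apply: bounded_borelZ; exact: bi.
- have := b01 (Some tau); rewrite !indicE.
  have [tK|tK] := boolP (tau \in K).
    have -> : (tau \in ~` K) = false by rewrite in_setC tK.
    have -> : (tau \in L) = false.
      by apply/negP => /set_mem/LK; apply; exact: set_mem.
    by rewrite /=; lra.
  have -> : (tau \in ~` K) by rewrite in_setC tK.
  have [tL|tL] := boolP (tau \in L); last by rewrite /=; lra.
  by have := bL _ (LL _ (set_mem tL)); rewrite /=; lra.
Qed.

(** No mass escapes to infinity: take twice the complement of a Urysohn function of
    a compact set that carries nearly the whole mass of both measures. *)
Lemma integ_tight mu nu (e : R) : 0 < e -> exists b,
  [/\ forall x, 0 <= gelfand1 b x, 1 <= gelfand1 b None, integ mu b <= e & integ nu b <= e].
Proof.
move=> e0; pose d := (e / 4) / (1 + e).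
have d0 : 0 < d by rewrite /d !divr_gt0//; lra.
have de : 4 * d <= e.
  rewrite /d; have -> : 4 * (e / 4 / (1 + e)) = e / (1 + e) by field; lra.
  by rewrite ler_pdivrMr; nra.
have d2 : d <= 1 / 2.
  rewrite /d ler_pdivrMr; lra.
have hS := @spectrum_hausdorff R A.
have mT : <<s @open (spectrum A) >> setT by apply: sub_sigma_algebra; exact: openT.
have [K1 [cK1 _ muK1]] := mass_inner mu hS mT d0.
have [K2 [cK2 _ nuK2]] := mass_inner nu hS mT d0.
rewrite !massT in muK1 nuK2.
have [b [b01 bK _ bo]] := spectrum_urysohn (compactU cK1 cK2) compact0 (setI0 _) d0.
exists (2 *: (1 - b)).
have H m K : compact K -> K `<=` K1 `|` K2 -> 1 <= mass m K + d ->
    integ m (2 *: (1 - b)) <= e.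
  move=> cK KK mK.
  have [_ iD iN iZ] := scalar_morph (integ_scalar m).
  rewrite iZ iD iN integ1.
  have : (1 - d) * mass m K <= integ m b.
    apply: integ_ge_mass => //; first lra.
      by move=> tau; have /andP[] := b01 (Some tau).
    by move=> tau /KK; exact: bK.
  by nra.
split.
- by move=> x; rewrite gelfand1Z gelfand1D gelfand1N gelfand1_1; have := b01 x; lra.
- by rewrite gelfand1Z gelfand1D gelfand1N gelfand1_1; lra.
- exact: (H mu K1).
- exact: (H nu K2).
Qed.

Section layer_cake.
Variables (mu : M1 R (spectrum A)) (J : B -> R).
Hypotheses (JL : scalar J) (J1 : J 1 = 1).
Hypothesis J_ge0 : forall b, (forall x, 0 <= gelfand1 b x) -> 0 <= J b.
Hypothesis J_tight : forall e : R, 0 < e -> exists b,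
  [/\ forall x, 0 <= gelfand1 b x, 1 <= gelfand1 b None & J b <= e].
Hypothesis J_majorant : forall K (e : R), compact K -> 0 < e ->
  exists2 c, majorants K c & J c <= mass mu K + e.

Lemma J_le b c : (forall x, gelfand1 b x <= gelfand1 c x) -> J b <= J c.
Proof.
move=> bc; have [_ JD JN _] := scalar_morph JL.
rewrite -subr_ge0 -JN -JD; apply: J_ge0 => x.
by rewrite gelfand1D gelfand1N subr_ge0.
Qed.

(** Up to [1 / n], the transform of [b] is at most the mean of majorants of its [n]
    superlevel sets, and the mean mass of these sets is at most the integral of [b].
    The superlevel sets are cut down to a compact set [K0] outside which twice an
    element [b0] with small value under [J] is at least 1. *)
Lemma layer_cake_le b : (forall x, 0 <= gelfand1 b x <= 1) -> J b <= integ mu b.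
Proof.
move=> b01; have [J0 JD JN JZ] := scalar_morph JL.
have hS := @spectrum_hausdorff R A.
apply/ler_addgt0Pr => e e0; pose d := e / 4.
have d0 : 0 < d by rewrite /d; lra.
have [b0 [b0_ge0 b0o Jb0]] := J_tight d0.
have : 0 <= d^-1 by rewrite invr_ge0 ltW.
move=> /archi_boundP; set n := Num.bound _ => nd.
have n0 : 0 < n%:R :> R by apply: lt_trans nd; rewrite invr_gt0.
pose K0 : set (spectrum A) := [set tau | - 2^-1 <= gelfand1 (- b0) (Some tau)].
have cK0 : compact K0 by apply: spectrum_compact; rewrite gelfand1N; lra.
pose K k : set (spectrum A) := K0 `&` [set tau | k.+1%:R / n%:R <= gelfand1 b (Some tau)].
have cK k : compact (K k).
  apply: compact_closedI => //.
  rewrite (_ : [set tau | _] =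
    (fun tau => gelfand1 b (Some tau)) @^-1` [set x | k.+1%:R / n%:R <= x])//.
  apply: closed_comp; last exact: closed_ge.
  by move=> tau _; exact: gelfand1_continuous.
have /choice[c cP] k : exists c, majorants (K k) c /\ J c <= mass mu (K k) + d.
  by have [c Kc Jc] := J_majorant (cK k) d0; exists c.
have bsum m x : gelfand1 (\sum_(k < m) c k) x = \sum_(k < m) gelfand1 (c k) x.
  elim: m => [|m IH]; last by rewrite !big_ord_recr/= gelfand1D IH.
  by rewrite !big_ord0 -(scale0r (1 : B)) gelfand1C.
have Jsum m : J (\sum_(k < m) c k) = \sum_(k < m) J (c k).
  by elim: m => [|m IH]; [rewrite !big_ord0|rewrite !big_ord_recr/= JD IH].
have step (y : R) k : (k.+1%:R / n%:R <= y) = (k.+1%:R <= n%:R * y).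
  by rewrite ler_pdivrMr// mulrC.
have up : J b <= J (n%:R^-1 *: (1 + \sum_(k < n) c k) + 2 *: b0).
  apply: J_le => x; rewrite gelfand1D !gelfand1Z gelfand1D gelfand1_1 bsum.
  have sge0 : 0 <= \sum_(k < n) gelfand1 (c k) x.
    by apply: sumr_ge0 => k _; have [[+ _] _] := cP k; apply.
  have [xK|xK] := leP (gelfand1 b0 x) 2^-1; last first.
    have : 0 <= n%:R^-1 * (1 + \sum_(k < n) gelfand1 (c k) x).
      by rewrite mulr_ge0 ?invr_ge0 ?ltW//; lra.
    have := b01 x; lra.
  case: x xK sge0 => [tau|] xK sge0; last by lra.
  have b0tau := b0_ge0 (Some tau).
  apply: (@le_trans _ _ (n%:R^-1 * (1 + \sum_(k < n) gelfand1 (c k) (Some tau)))).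
    rewrite ler_pdivlMl//.
    have := b01 (Some tau) => b01t.
    have : n%:R * gelfand1 b (Some tau) <= n%:R by rewrite ler_piMr; lra.
    move=> /sum_steps_ge h.
    suff : \sum_(k < n) (k.+1%:R <= n%:R * gelfand1 b (Some tau))%R%:R <=
      \sum_(k < n) gelfand1 (c k) (Some tau) by lra.
    apply: ler_sum => k _; have [[c0 c1] _] := cP k.
    case: (boolP (k.+1%:R <= _)%R) => [h'|_]; last by rewrite mulr0n; exact: c0.
    by rewrite mulr1n; apply: c1; split; [rewrite /K0/= gelfand1N; lra|rewrite /= step].
  by lra.
have masses : \sum_(k < n) mass mu (K k) <= n%:R * integ mu b.
  pose ind k : spectrum A -> R := \1_(K k).
  have bK k : bounded_borel mu (ind k).
    by apply: bounded_borel_indic; exact: (borel_compact mu hS (cK k)).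
  rewrite -expectZ; last exact: gelfand1_bounded_borel.
  under eq_bigr do rewrite -(expect_indic mu (borel_compact mu hS (cK _))).
  rewrite -(@expect_sum _ _ mu n ind)//; apply: le_expect => [||tau].
  - exact: (@bounded_borel_sum _ _ mu n ind).
  - by apply: bounded_borelZ; exact: gelfand1_bounded_borel.
  - have w0 : 0 <= n%:R * gelfand1 b (Some tau).
      by rewrite mulr_ge0//; have /andP[] := b01 (Some tau).
    apply: le_trans (sum_steps_le n w0); apply: ler_sum => k _.
    rewrite /ind indicE; case: (boolP (tau \in _)) => // /set_mem[_ /=].
    by rewrite step => ->.
apply: (le_trans up); rewrite JD !JZ JD J1 Jsum.
have : \sum_(k < n) J (c k) <= \sum_(k < n) (mass mu (K k) + d).
  by apply: ler_sum => k _; have [] := cP k.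
rewrite big_split/= sumr_const card_ord -mulr_natl => Jc.
have : n%:R^-1 * (1 + \sum_(k < n) J (c k)) <= n%:R^-1 * (1 + (n%:R * integ mu b + n%:R * d)).
  by rewrite ler_pM2l ?invr_gt0//; lra.
rewrite !mulrDr mulr1 !mulKf ?gt_eqF//.
have : n%:R^-1 <= d by rewrite -[d]invrK lef_pV2 ?posrE ?invr_gt0// ltW.
by rewrite /d in Jb0 *; lra.
Qed.

(** The inequalities of the previous lemma for [b] and for [1 - b] add up to an
    equality; scaling and shifting reduce every element to this case. *)
Theorem layer_cake_representation b : J b = integ mu b.
Proof.
have [J0 JD JN JZ] := scalar_morph JL.
have [i0 iD iN iZ] := scalar_morph (integ_scalar mu).
have eq01 c : (forall x, 0 <= gelfand1 c x <= 1) -> J c = integ mu c.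
  move=> c01; apply/eqP; rewrite eq_le layer_cake_le//=.
  have : J (1 - c) <= integ mu (1 - c).
    by apply: layer_cake_le => x; rewrite gelfand1D gelfand1N gelfand1_1; have := c01 x; lra.
  by rewrite JD JN J1 iD iN integ1; lra.
have [_ _ _ /(_ _ (imageT (@gelfand1 _ _ amulC) b))[M bM]] := gelfand1_algebra amulC.
have M0 : 0 <= M by exact: le_trans (bM None).
pose k := (2 * M + 1)^-1.
have k0 : 0 < k by rewrite invr_gt0; lra.
have : J (k *: (b + M *: 1)) = integ mu (k *: (b + M *: 1)).
  apply: eq01 => x; rewrite gelfand1Z gelfand1D gelfand1C.
  have := bM x; rewrite ler_norml => bx.
  apply/andP; split; first by apply: mulr_ge0; [exact: ltW|lra].
  by rewrite /k ler_pdivrMl; lra.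
rewrite JZ iZ JD iD JZ iZ J1 integ1 => /(mulfI (lt0r_neq0 k0)).
by move=> /addIr.
Qed.

End layer_cake.

End spectrum_functionals.

(** * The representing measure of a state *)

Section state_measure.
Context {R : realType} {A : normedStarAlgType R}.
Variable amulC : commutative (@amul R A).
Local Notation B := (unitization amulC).
Variable phi : A -> R[i].
Hypothesis phi_state : states A phi.
Implicit Types (b c : B) (K L : set (spectrum A)).

Let J : B -> R := phi1 phi.

Let JL : scalar J. Proof. exact: phi1_scalar phi_state. Qed.
Let JD : {morph J : a b / a + b}. Proof. by case: (scalar_morph JL). Qed.
Let JN : {morph J : a / - a}. Proof. by case: (scalar_morph JL). Qed.
Let JZ r b : J (r *: b) = r * J b. Proof. by case: (scalar_morph JL). Qed.
Let J1 : J 1 = 1. Proof. exact: phi1_1 phi_state. Qed.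

Let J_ge0 b : (forall x, 0 <= gelfand1 b x) -> 0 <= J b.
Proof. exact: phi1_pos phi_state b. Qed.

Lemma state_re_im (a : A) : phi a = J (re_elt amulC a) +i* J (im_elt amulC a).
Proof.
have [_ phiD _ phiZ] : [/\ phi 0 = 0, {morph phi : a b / a + b}, {morph phi : a / - a}
    & forall k a, phi (k *: a) = k * phi a].
  by apply: scalar_morph; case: phi_state => -[].
rewrite [a in LHS]re_im_part /J /phi1/= !addr0.
have := state_sa_real amulC phi_state (re_part_sa a).
have := state_sa_real amulC phi_state (im_part_sa a).
move: (re_part a) (im_part a) => p q hq hp; rewrite phiD phiZ hp hq /=.
by simpc.
Qed.

(** The variation of a state is 1: some [a], normalised by
    [phi a = phi (a^* a) = t], has [t] close to 1, and then
    [|1 - a|^2] is an element whose value under the state is [1 - t]. *)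
Lemma state_tight (e : R) : 0 < e -> exists b,
  [/\ forall x, 0 <= gelfand1 b x, 1 <= gelfand1 b None & J b <= e].
Proof.
move=> e0.
have [[phiL phi_ge0] _ [_ phi_lb]] := phi_state.
have [_ phiD phiN phiZ] := scalar_morph phiL.
pose v := Num.max 0 (1 - e).
have v1 : v < 1 by rewrite /v gt_max ltr01; lra.
have v0 : 0 <= v by rewrite /v le_max lexx.
have [a Ha] : exists a : A, v * complex.Re (phi (amul (star a) a)) <
    complex.Re (phi a) ^+ 2 + complex.Im (phi a) ^+ 2.
  apply: contrapT => H; suff /phi_lb : variation_bounds phi v by rewrite leNgt v1.
  split=> // a; rewrite -add_Re2_Im2 (state_sq_real phi_state) -rmorphM lecR leNgt.
  by apply/negP => h; apply: H; exists a.
have s0 := state_sq_real phi_state a.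
have var := state_variation phi_state a.
set m := complex.Re (phi a) ^+ 2 + _ in Ha var.
set q := complex.Re (phi (amul _ _)) in s0 Ha var.
have q_ge0 : 0 <= q by rewrite -ler0c -s0; exact: phi_ge0.
have q0 : 0 < q.
  rewrite lt_neqAle q_ge0 andbT eq_sym; apply/eqP => q0; move: Ha var.
  by rewrite q0; lra.
pose k := conjc (phi a) * (q^-1)%:C.
pose t := m / q.
have phika : phi (k *: a) = t%:C.
  rewrite phiZ /k /t /m mulrAC rmorphM; congr (_ * _).
  case: (phi a) => x y; rewrite /= !expr2; simpc.
  by congr (_ +i* _); ring.
have phika2 : phi (amul (star (k *: a)) (k *: a)) = t%:C.
  rewrite starZ amulZl amulZr !phiZ s0 conjE /k /t /m.
  case: (phi a) => x y /=; rewrite !expr2; simpc.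
  by congr (_ +i* _); field; rewrite gt_eqF.
have tv : v < t by rewrite /t ltr_pdivlMr.
pose c := k *: a.
have cc_sa : selfadjoint (amul (star c) c) by rewrite /selfadjoint/= starM starK.
pose r : B := re_elt amulC c.
pose b : B := unit_in amulC (sa_mk cc_sa) + (-2) *: r + 1.
have bNone : gelfand1 b None = 1.
  by rewrite /b !gelfand1D gelfand1Z gelfand1_1 /gelfand1/= !addr0 mulr0 !add0r.
exists b; split; last 1 first.
- have Jr : J r = t.
    by have := state_re_im c; rewrite phika => -[].
  have Jcc : J (unit_in amulC (sa_mk cc_sa)) = t.
    by rewrite /J phi1_unit_in /= phika2.
  rewrite /b !JD JZ J1 Jr Jcc.
  have : 1 - e <= v by rewrite /v le_max lexx orbT.
  lra.
- case=> [tau|]; last by rewrite bNone.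
  rewrite /b !gelfand1D gelfand1Z gelfand1_1 gelfand1_re_elt.
  rewrite /gelfand1/= addr0 gelfandM gelfand_star.
  case: (gelfand c tau) => x y /=; rewrite mulNr opprK.
  have := sqr_ge0 (1 - x); have := sqr_ge0 y; rewrite !expr2; nra.
- by rewrite bNone.
Qed.

Definition state_content K : R := inf [set J b | b in majorants (amulC:=amulC) K].

Lemma majorants_1 K : majorants (amulC:=amulC) K 1.
Proof. by split=> [x|tau _]; rewrite gelfand1_1. Qed.

Lemma state_content_inf K : has_inf [set J b | b in majorants (amulC:=amulC) K].
Proof.
split; first by exists (J 1), 1 => //; exact: majorants_1.
by exists 0 => _ [b [b0 _] <-]; exact: J_ge0.
Qed.

Lemma state_content_le K b : majorants (amulC:=amulC) K b -> state_content K <= J b.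
Proof. by move=> Kb; apply: ge_inf; [case: (state_content_inf K)|exists b]. Qed.

Lemma state_content_ge K (r : R) : (forall b, majorants (amulC:=amulC) K b -> r <= J b) ->
  r <= state_content K.
Proof.
move=> H; apply: lb_le_inf; first by case: (state_content_inf K).
by move=> _ [b Kb <-]; exact: H.
Qed.

Lemma state_content_adherent K (e : R) : 0 < e ->
  exists2 b, majorants (amulC:=amulC) K b & J b <= state_content K + e.
Proof.
move=> e0; have [_ [b Kb <-] be] := inf_adherent e0 (state_content_inf K).
by exists b => //; exact: ltW.
Qed.

(** For the additivity over disjoint compact sets a majorant [c] of the union is cut
    into [c b] and [c (1 - b)] by a Urysohn function [b]. Tightness holds because a
    majorant of the compact set where the element of [state_tight] is at most [1/2]
    becomes at least 1 everywhere after adding twice that element. *)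
Theorem state_measure : exists mu : M1 R (spectrum A),
  forall K, compact K -> M1_prob mu K = (state_content K)%:E.
Proof.
have hS := @spectrum_hausdorff R A.
apply: content_representation => //.
- by move=> K _; apply: state_content_ge => b [b0 _]; exact: J_ge0.
- by move=> K _; rewrite -J1; apply: state_content_le; exact: majorants_1.
- move=> K L _ _; apply/ler_addgt0Pr => e e0.
  have e2 : 0 < e / 2 by lra.
  have [b [b0 bK] Jb] := state_content_adherent K e2.
  have [c [c0 cL] Jc] := state_content_adherent L e2.
  have : state_content (K `|` L) <= J (b + c).
    apply: state_content_le; split=> [x|tau]; rewrite gelfand1D.
      by apply: addr_ge0; [exact: b0|exact: c0].
    by case=> [/bK|/cL]; have := b0 (Some tau); have := c0 (Some tau); lra.
  by rewrite JD; lra.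
- move=> K L cK cL KL; apply/ler_addgt0Pr => e e0; pose d := e / 3.
  have d0 : 0 < d by rewrite /d; lra.
  have [c [c0 cKL] Jc] := state_content_adherent (K `|` L) d0.
  have [b [b01 bK bL _]] := spectrum_urysohn amulC cK cL KL d0.
  have : state_content K <= J (c * b + d *: 1).
    apply: state_content_le; split=> [x|tau Kt];
      rewrite gelfand1D gelfand1M gelfand1C.
      have := b01 x; have := c0 x; nra.
    have := bK _ Kt; have := cKL _ (or_introl Kt); have := b01 (Some tau); nra.
  have : state_content L <= J (c * (1 - b) + d *: 1).
    apply: state_content_le; split=> [x|tau Lt];
      rewrite gelfand1D gelfand1M gelfand1C gelfand1D gelfand1N gelfand1_1.
      have := b01 x; have := c0 x; nra.
    have := bL _ Lt; have := cKL _ (or_intror Lt); have := b01 (Some tau); nra.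
  rewrite mulrBr mulr1 !JD JN JZ J1.
  by rewrite /d in Jc *; lra.
- move=> e e0; have e4 : 0 < e / 2 by lra.
  have [b [b0 bo Jb]] := state_tight e4.
  exists [set tau | - 2^-1 <= gelfand1 (- b) (Some tau)].
    by apply: spectrum_compact; rewrite gelfand1N; lra.
  apply: state_content_ge => c [c0 cK].
  have : 0 <= J (c + 2 *: b - 1).
    apply: J_ge0 => x; rewrite !gelfand1D gelfand1N gelfand1_1 gelfand1Z.
    have := c0 x; case: x => [tau|]; last by lra.
    have := cK tau; rewrite /= gelfand1N.
    have [bt|bt] := leP (gelfand1 b (Some tau)) 2^-1; last by lra.
    by move=> /(_ ltac:(lra)); have := b0 (Some tau); lra.
  by rewrite !JD JN JZ J1; lra.
- move=> K e cK e0; pose d := e / (3 + e).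
  have d0 : 0 < d by rewrite divr_gt0//; lra.
  have d1 : d <= 1 by rewrite /d ler_pdivrMr; lra.
  have d3 : d * 3 <= e.
    by rewrite /d mulrAC ler_pdivrMr; nra.
  have [c [c0 cK'] Jc] := state_content_adherent K d0.
  exists [set tau | (1 + d)^-1 < gelfand1 c (Some tau)]; split.
  + rewrite (_ : [set tau | _] =
      (fun tau => gelfand1 c (Some tau)) @^-1` [set x | (1 + d)^-1 < x])//.
    by apply: open_comp; [move=> tau _; exact: gelfand1_continuous|exact: open_gt].
  + move=> tau /cK'; apply: lt_le_trans; rewrite invf_lt1; lra.
  + move=> L cL LU.
    have : state_content L <= J ((1 + d) *: c).
      apply: state_content_le; split=> [x|tau /LU /=]; rewrite gelfand1Z.
        by rewrite mulr_ge0//; lra.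
        by move=> /ltW h; rewrite -ler_pdivrMl ?mulr1//; lra.
    have : state_content K <= 1.
      by rewrite -J1; apply: state_content_le; exact: majorants_1.
    rewrite JZ; nra.
Qed.

Lemma state_integral : exists mu : M1 R (spectrum A), forall b, J b = integ mu b.
Proof.
have [mu muK] := state_measure; exists mu => b.
apply: layer_cake_representation.
- exact: phi1_scalar phi_state.
- exact: J1.
- exact: J_ge0.
- exact: state_tight.
- move=> K e cK e0; have [c Kc Jc] := state_content_adherent K e0.
  by exists c => //; rewrite /mass muK.
Qed.

End state_measure.

(** * The transform of measures *)

Section transform.
Context {R : realType} {A : normedStarAlgType R}.
Variable amulC : commutative (@amul R A).
Local Notation B := (unitization amulC).
Implicit Types (b c : B) (K L : set (spectrum A)) (mu nu rho : M1 R (spectrum A)).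

Lemma bochnerE mu a : bochner mu a = integ mu (re_elt amulC a) +i* integ mu (im_elt amulC a).
Proof.
rewrite /bochner /cintegral; congr (_ +i* _); apply: eq_Rintegral => tau _.
- by rewrite gelfand1_re_elt.
- by rewrite gelfand1_im_elt.
Qed.

Lemma bochner_cintegrable mu a : cintegrable mu (gelfand a).
Proof.
split.
- rewrite (_ : (fun x => _) = EFin \o (fun tau => gelfand1 (re_elt amulC a) (Some tau))).
    by apply: bounded_borel_integrable; exact: gelfand1_bounded_borel.
  by apply/funext => tau; rewrite /= gelfand1_re_elt.
- rewrite (_ : (fun x => _) = EFin \o (fun tau => gelfand1 (im_elt amulC a) (Some tau))).
    by apply: bounded_borel_integrable; exact: gelfand1_bounded_borel.
  by apply/funext => tau; rewrite /= gelfand1_im_elt.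
Qed.

Lemma integ_ext mu b c :
  (forall tau, gelfand1 b (Some tau) = gelfand1 c (Some tau)) -> integ mu b = integ mu c.
Proof. by move=> bc; apply/eqP; rewrite eq_le !integ_le// => tau; rewrite bc. Qed.

Lemma bochner_scalar mu : scalar (bochner mu).
Proof.
move=> k a b; rewrite !bochnerE.
have [_ iD iN iZ] := scalar_morph (integ_scalar (amulC:=amulC) mu).
have -> : integ mu (re_elt amulC (k *: a + b)) = complex.Re k * integ mu (re_elt amulC a)
    - complex.Im k * integ mu (im_elt amulC a) + integ mu (re_elt amulC b).
  rewrite -!iZ -iN -!iD; apply: integ_ext => tau.
  rewrite !gelfand1D gelfand1N !gelfand1Z !gelfand1_re_elt gelfand1_im_elt.
  by rewrite gelfandD gelfandZ ReD complex_ReM.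
have -> : integ mu (im_elt amulC (k *: a + b)) = complex.Re k * integ mu (im_elt amulC a)
    + complex.Im k * integ mu (re_elt amulC a) + integ mu (im_elt amulC b).
  rewrite -!iZ -!iD; apply: integ_ext => tau.
  rewrite !gelfand1D !gelfand1Z gelfand1_re_elt !gelfand1_im_elt.
  by rewrite gelfandD gelfandZ ImD complex_ImM.
by case: k => x y /=; simpc.
Qed.

Lemma bochner_sa mu (a : sa_part A) : bochner mu (a : A) = (integ mu (unit_in amulC a))%:C.
Proof.
rewrite bochnerE; congr (_ +i* _).
  by apply: integ_ext => tau; rewrite gelfand1_re_elt /gelfand1/= addr0.
have [<- _ _ iZ] := scalar_morph (integ_scalar (amulC:=amulC) mu).
apply: integ_ext => tau.
by rewrite gelfand1_im_elt (gelfand_sa tau (sa_partP a)) -(scale0r (1 : B)) gelfand1C.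
Qed.

Lemma bochner_sa_le mu (a : A) : selfadjoint a -> `|bochner mu a| <= `|a|.
Proof.
move=> sa; rewrite -[a]/(sa_mk sa : A) bochner_sa nrmE normc_def/= expr0n addr0 sqrtr_sqr lecR.
have [_ iD iN iZ] := scalar_morph (integ_scalar (amulC:=amulC) mu).
have bnd tau : `|gelfand1 (unit_in amulC (sa_mk sa)) (Some tau)| <= nrm a.
  by rewrite /gelfand1/= addr0; exact: gelfand_le_nrm.
have iC (r : R) : integ mu (r *: (1 : B)) = r by rewrite iZ integ1 mulr1.
rewrite ler_norml -{1}(iC (- nrm a)) -{2}(iC (nrm a)).
by apply/andP; split; apply: integ_le => tau; rewrite gelfand1C;
  have := bnd tau; rewrite ler_norml => /andP[].
Qed.

Lemma bochner_weakly_continuous mu : weakly_continuous_sa (bochner mu).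
Proof.
move=> b; apply/subspace_continuousP => x sx; apply/cvgrPdist_lt => e e0.
pose N := `|star b| * `|b| + 1.
have N0 : 0 < N by rewrite ltr_wpDl// mulr_ge0.
rewrite near_withinE; apply/nbhs_normP; exists (e / N); first exact: divr_gt0.
move=> y /= xy sy; rewrite /from_subspace.
have [_ bD bN _] := scalar_morph (bochner_scalar mu).
rewrite -bN -bD.
have -> : amul (amul (star b) x) b - amul (amul (star b) y) b =
    amul (amul (star b) (x - y)) b.
  have Nl (u v : A) : amul u (- v) = - amul u v by rewrite -scaleN1r amulZr scaleN1r.
  have Nr (u v : A) : amul (- u) v = - amul u v by rewrite -scaleN1r amulZl scaleN1r.
  by rewrite amulDr Nl amulDl Nr.
have sd : selfadjoint (amul (amul (star b) (x - y)) b).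
  by rewrite /selfadjoint/= !starM starK starB sx sy amulA.
apply: le_lt_trans (bochner_sa_le mu sd) _.
apply: (@le_lt_trans _ _ (`|x - y| * N)); last by rewrite -ltr_pdivlMr.
apply: le_trans (ler_normM _ _) _.
apply: (@le_trans _ _ (`|star b| * `|x - y| * `|b|)).
  by apply: ler_wpM2r => //; exact: ler_normM.
by rewrite mulrAC mulrC ler_wpM2l// lerDl.
Qed.

Lemma integ_sqr_le mu b : integ mu b ^+ 2 <= integ mu (b * b).
Proof.
have [_ iD iN iZ] := scalar_morph (integ_scalar (amulC:=amulC) mu).
set m := integ mu b.
have : 0 <= integ mu ((b - m *: 1) * (b - m *: 1)).
  by apply: integ_ge0 => x; rewrite gelfand1M -expr2 sqr_ge0.
have -> : integ mu ((b - m *: 1) * (b - m *: 1)) =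
    integ mu (b * b + (- (2 * m)) *: b + (m * m) *: 1).
  apply: integ_ext => tau; rewrite !(gelfand1D, gelfand1M, gelfand1Z, gelfand1N, gelfand1_1).
  ring.
by rewrite !iD !iZ integ1 -/m expr2; lra.
Qed.

Lemma bochner_square mu a : bochner mu (amul (star a) a) =
  (integ mu (re_elt amulC a * re_elt amulC a + im_elt amulC a * im_elt amulC a))%:C.
Proof.
have sa : selfadjoint (amul (star a) a) by rewrite /selfadjoint/= starM starK.
rewrite -[amul (star a) a]/(sa_mk sa : A) bochner_sa; congr (_ %:C).
apply: integ_ext => tau; rewrite gelfand1D !gelfand1M gelfand1_re_elt gelfand1_im_elt.
rewrite /gelfand1/= addr0 gelfandM gelfand_star.
by case: (gelfand a tau) => x y /=; ring.
Qed.

(** That no constant smaller than 1 bounds the variation is seen at an element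
    whose transform is close to 1 on a compact set of nearly full mass. *)
Lemma bochner_variation mu : has_variation (bochner mu) 1.
Proof.
have [_ iD iN iZ] := scalar_morph (integ_scalar (amulC:=amulC) mu).
split.
  split=> // a; rewrite mul1r bochner_square -add_Re2_Im2 lecR bochnerE/= iD.
  by apply: lerD; exact: integ_sqr_le.
move=> v [v0 Hv]; apply/ler_addgt0Pr => e e0.
pose d := e / (6 + 6 * e).
have d0 : 0 < d by rewrite divr_gt0//; lra.
have d6 : 6 * d <= e by rewrite /d mulrA ler_pdivrMr; nra.
have d1 : d <= 1 / 6 by rewrite /d ler_pdivrMr; lra.
have hS := @spectrum_hausdorff R A.
have mT : <<s @open (spectrum A) >> setT by apply: sub_sigma_algebra; exact: openT.
have [K [cK _]] := mass_inner mu hS mT d0; rewrite massT => muK.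
have [b [b01 bK _ bo]] := spectrum_urysohn amulC cK compact0 (setI0 _) d0.
pose r := b.2; pose a := b.1.
have bNone : gelfand1 b None = r by rewrite /gelfand1 add0r.
have r0 : 0 <= r <= d by have := b01 None; rewrite bNone in bo *; lra.
have ab : unit_in amulC a = b - r *: 1 by rewrite [in RHS](unit_decomp b) addrK.
have ib : (1 - d) * (1 - d) <= integ mu b.
  apply: (@le_trans _ _ ((1 - d) * mass mu K)).
    by apply: ler_wpM2l; lra.
  apply: integ_ge_mass => //; first lra.
  by move=> tau; have /andP[] := b01 (Some tau).
have ia : integ mu (unit_in amulC a) = integ mu b - r.
  by rewrite ab iD iN iZ integ1 mulr1.
have iaa : integ mu (unit_in amulC a * unit_in amulC a) <= 1.
  rewrite -(integ1 amulC mu); apply: integ_le => tau.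
  rewrite gelfand1M gelfand1_1 ab gelfand1D gelfand1N gelfand1C.
  by have := b01 (Some tau); nra.
have := Hv a; rewrite (sa_partP a).
have -> : bochner mu (amul a a) = (integ mu (unit_in amulC a * unit_in amulC a))%:C.
  rewrite -[amul a a]/(sa_mul amulC a a : A) bochner_sa; congr (_ %:C).
  by apply: integ_ext => tau; rewrite gelfand1M /gelfand1/= !addr0 gelfandM
    (gelfand_sa tau (sa_partP a)) -rmorphM.
rewrite bochner_sa -add_Re2_Im2/= expr0n addr0 -rmorphM lecR ia.
set I1 := integ mu b in ib *; set I2 := integ mu _ in iaa *.
have : 1 - 3 * d <= I1 - r by nra.
move=> h1 h2.
have : (1 - 3 * d) ^+ 2 <= (I1 - r) ^+ 2 by rewrite ler_sqr ?nnegrE; lra.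
have : v * I2 <= v * 1 by apply: ler_wpM2l.
rewrite expr2; nra.
Qed.

Lemma bochner_state mu : states A (bochner mu).
Proof.
split; [split|exact: bochner_weakly_continuous|exact: bochner_variation].
- exact: bochner_scalar.
- move=> a; rewrite bochner_square ler0c; apply: integ_ge0 => x.
  by rewrite gelfand1D !gelfand1M -!expr2 addr_ge0 ?sqr_ge0.
Qed.

Lemma bochner_integ mu nu : bochner mu = bochner nu ->
  forall b, integ mu b = integ nu b.
Proof.
move=> e b; rewrite (unit_decomp b).
have [_ iD _ iZ] := scalar_morph (integ_scalar (amulC:=amulC) mu).
have [_ jD _ jZ] := scalar_morph (integ_scalar (amulC:=amulC) nu).
rewrite iD jD iZ jZ !integ1; congr (_ + _).
by apply: complexI; rewrite -!bochner_sa e.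
Qed.

Lemma integ_mass_le mu nu : (forall b, integ mu b = integ nu b) ->
  forall K, compact K -> mass mu K <= mass nu K.
Proof.
move=> e K cK; apply/ler_addgt0Pr => d d0.
have [c [[c0 cK1] _ nuc]] := small_majorant amulC mu nu cK d0.
apply: le_trans nuc; rewrite -e -[mass mu K]mul1r.
by apply: integ_ge_mass.
Qed.

(** In one direction the integrals determine the masses of compact sets, and inner
    regularity the remaining ones. The converse goes through
    [layer_cake_representation], as the integrals refer to Borel spaces with
    different base points. *)
Lemma bochner_inj mu nu : bochner mu = bochner nu <-> M1_eq mu nu.
Proof.
have hS := @spectrum_hausdorff R A.
split=> [/bochner_integ e|e].
  have massK K : compact K -> M1_prob mu K = M1_prob nu K.
    move=> cK; have mK := borel_compact mu hS cK.
    rewrite (massE mu mK) (massE nu mK).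
    by congr (_%:E); apply/eqP; rewrite eq_le !integ_mass_le.
  move=> C mC; rewrite (M1_inner_regular mu mC) (M1_inner_regular nu mC).
  congr ereal_sup; apply/seteqP; split=> _ [K [cK KC] <-]; exists K => //;
    by rewrite massK.
apply/funext => a; suff ie b : integ mu b = integ nu b by rewrite !bochnerE !ie.
apply: (layer_cake_representation (mu := nu) (J := integ mu)).
- exact: integ_scalar.
- exact: integ1.
- exact: integ_ge0.
- by move=> d d0; have [c [c0 co ic _]] := integ_tight amulC mu mu d0; exists c.
- move=> K d cK d0; have [c [Kc ic _]] := small_majorant amulC mu mu cK d0.
  exists c => //; move: ic; rewrite /mass e//; exact: (borel_compact mu hS cK).
Qed.

(** The convex combination of the two integrals is approximated on compact sets by
    the masses of [rho], hence is the integral with respect to [rho]. *)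
Lemma bochner_convex mu nu rho (t : R) : 0 <= t <= 1 -> M1_conv t mu nu rho ->
  forall a, bochner rho a = t%:C * bochner mu a + (1 - t)%:C * bochner nu a.
Proof.
move=> t01 conv a.
have hS := @spectrum_hausdorff R A.
have [_ iD iN iZ] := scalar_morph (integ_scalar (amulC:=amulC) mu).
have [_ jD jN jZ] := scalar_morph (integ_scalar (amulC:=amulC) nu).
suff ie b : t * integ mu b + (1 - t) * integ nu b = integ rho b.
  by rewrite !bochnerE -!ie; simpc.
apply: (layer_cake_representation (J := fun b => t * integ mu b + (1 - t) * integ nu b)).
- by move=> r x y; rewrite !integ_scalar; ring.
- by rewrite !integ1; ring.
- by move=> c c0; rewrite addr_ge0// mulr_ge0 ?integ_ge0//; lra.
- move=> d d0; have [c [c0 co ic jc]] := integ_tight amulC mu nu d0; exists c; split=> //.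
  by nra.
- move=> K d cK d0; have [c [Kc ic jc]] := small_majorant amulC mu nu cK d0.
  exists c => //.
  have mK := borel_compact rho hS cK.
  have := conv _ mK; rewrite !massE//.
  rewrite -!EFinM -EFinD => -[->]; nra.
Qed.

End transform.

Section convex_combination.
Context {R : realType} {T : topologicalType}.
Variables (mu nu : M1 R T) (t : R).
Hypothesis t01 : 0 <= t <= 1.
Local Open Scope ereal_scope.

(** The Borel spaces of [mu] and [nu] have the same measurable sets and differ in
    their base points only; that of [mu] is kept. *)
Definition convex_measure : set (borel (M1_point mu)) -> \bar R :=
  fun C => t%:E * M1_prob mu C + (1 - t)%:E * M1_prob nu C.

Let t_ge0 : (0 <= t)%R. Proof. by case/andP: t01. Qed.
Let t_le1 : (0 <= 1 - t)%R. Proof. by rewrite subr_ge0; case/andP: t01. Qed.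

Let convex_measure0 : convex_measure set0 = 0.
Proof. by rewrite /convex_measure !measure0 !mule0 adde0. Qed.

Let convex_measure_ge0 C : 0 <= convex_measure C.
Proof. by rewrite adde_ge0// mule_ge0// lee_fin. Qed.

Let convex_measure_sigma_additive : semi_sigma_additive convex_measure.
Proof.
move=> F mF tF mUF.
have muF := @measure_semi_sigma_additive _ _ _ mu F mF tF mUF.
have nuF := @measure_semi_sigma_additive _ _ _ nu F mF tF mUF.
rewrite /convex_measure.
under eq_fun do rewrite big_split/= -!ge0_sume_distrr//.
apply: cvgeD.
- by rewrite ge0_adde_def// inE mule_ge0// lee_fin.
- by apply: cvgeZl.
- by apply: cvgeZl.
Qed.

HB.instance Definition _ := isMeasure.Build _ _ R convex_measure
  convex_measure0 convex_measure_ge0 convex_measure_sigma_additive.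

Let convex_measureT : convex_measure setT = 1.
Proof.
rewrite /convex_measure (_ : M1_prob mu setT = 1); last exact: probability_setT.
rewrite (_ : M1_prob nu setT = 1); last exact: probability_setT.
by rewrite !mule1 -EFinD addrC subrK.
Qed.

HB.instance Definition _ :=
  Measure_isProbability.Build _ _ R convex_measure convex_measureT.

Hypothesis hT : hausdorff_space T.

Let convex_measure_inner_regular : inner_regular convex_measure.
Proof.
move=> C mC; apply/eqP; rewrite eq_le; apply/andP; split; last first.
  apply: ge_ereal_sup => _ [K [cK KC] <-].
  by apply: le_measure => //; rewrite inE//; exact: (borel_compact mu hT).
apply/lee_addgt0Pr => e e0.
have [K1 [cK1 K1C muK1]] := mass_inner mu hT mC e0.
have [K2 [cK2 K2C nuK2]] := mass_inner nu hT mC e0.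
have cK : compact (K1 `|` K2) by exact: compactU.
have mK1 := borel_compact mu hT cK1; have mK2 := borel_compact nu hT cK2.
have mK := borel_compact mu hT cK.
apply: (@le_trans _ _ (convex_measure (K1 `|` K2) + e%:E)); last first.
  apply: leeD2r; apply: ereal_sup_ubound; exists (K1 `|` K2) => //; split=> //.
  by rewrite subUset.
rewrite /convex_measure !massE// -!EFinM -!EFinD lee_fin.
have := le_mass mu mK1 mK (@subsetUl _ _ _).
have := le_mass nu mK2 mK (@subsetUr _ _ _).
have := t_ge0; have := t_le1.
nra.
Qed.

Lemma exists_convex_combination : exists rho : M1 R T, M1_conv t mu nu rho.
Proof. by exists (BuildM1 convex_measure_inner_regular). Qed.

End convex_combination.

Theorem theorem30p7 (R : realType) (A : normedStarAlgType R)
    (amulC : commutative (@amul R A)) :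
  [/\ forall (mu : M1 R (spectrum A)) (a : A), cintegrable mu (gelfand a),
      forall mu : M1 R (spectrum A), states A (bochner mu),
      forall mu nu : M1 R (spectrum A), bochner mu = bochner nu <-> M1_eq mu nu,
      forall phi : A -> R[i], states A phi ->
        exists mu : M1 R (spectrum A), bochner mu = phi
    & forall (mu nu : M1 R (spectrum A)) (t : R), 0 <= t <= 1 ->
        (exists rho : M1 R (spectrum A), M1_conv t mu nu rho) /\
        (forall rho : M1 R (spectrum A), M1_conv t mu nu rho ->
           forall a : A,
             bochner rho a = t%:C * bochner mu a + (1 - t)%:C * bochner nu a)].
Proof.
split.
- by move=> mu a; exact: bochner_cintegrable.
- by move=> mu; exact: bochner_state.
- by move=> mu nu; exact: bochner_inj.
- move=> phi phi_state; have [mu muE] := state_integral amulC phi_state.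
  exists mu; apply/funext => a.
  by rewrite (bochnerE amulC) (state_re_im amulC phi_state) !muE.
- move=> mu nu t t01; split.
    by apply: exists_convex_combination => //; exact: spectrum_hausdorff.
  by move=> rho; exact: bochner_convex.
Qed.
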